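(* Let $1<p<\frac{N+2\gamma}{1+2\gamma}$ and $\frac1p+\frac1q=1$. Then there is a constant $c>0$, independent of $f$, such that for every $f\in C_c^{\infty}(\mathbb{R}^N)$ $$\int_{\mathbb{R}^N}|f|^{2}\,d\mu_{k}\leq c\left(\int_{\mathbb{R}^N}|\nabla_{k}f|^{p}\,d\mu_{k}\right)^{\frac{1}{p}}\left(\int_{\mathbb{R}^N}|x|^{q}|f|^{q}\,d\mu_{k}\right)^{\frac{1}{q}}.$$
   Context: Dunkl setting. $N\ge 1$ is an integer. $R\subset\mathbb{R}^N\setminus\{0\}$ is a fixed finite root system: $R\cap\alpha\mathbb{R}=\{-\alpha,\alpha\}$ and $\sigma_\alpha(R)=R$ for all $\alpha\in R$, where $\sigma_\alpha x=x-2\frac{\langle\alpha,x\rangle}{\langle\alpha,\alpha\rangle}\alpha$; roots are normalised by $|\alpha|^2=2$. $G$ is the finite group generated by the $\sigma_\alpha$. $k:R\to[0,\infty)$, $\alpha\mapsto k_\alpha$, is a fixed $G$-invariant function ($k_{g\alpha}=k_\alpha$ for all $g\in G$). $R_+$ is a fixed positive subsystem ($R=R_+\sqcup(-R_+)$), and $\gamma=\sum_{\alpha\in R_+}k_\alpha$. Dunkl operators: for $i=1,\dots,N$, $$T_if(x)=\partial_if(x)+\sum_{\alpha\in R_+}k_\alpha\alpha_i\frac{f(x)-f(\sigma_\alpha x)}{\langle\alpha,x\rangle}.$$ The Dunkl gradient is $\nabla_k=(T_1,\dots,T_N)$. The measure is $d\mu_k=w_k(x)\,dx$ with $w_k(x)=\prod_{\alpha\in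 R_+}|\langle\alpha,x\rangle|^{2k_\alpha}$. *)

(* Defs.v *)
From HB Require Import structures.
From mathcomp Require Import all_boot all_order all_algebra finmap.
From mathcomp Require Import all_classical all_reals all_analysis.
From mathcomp Require Import measurable_realfun.

Set Implicit Arguments.
Unset Strict Implicit.
Unset Printing Implicit Defensive.

Import Order.TTheory GRing.Theory Num.Theory.
Import numFieldNormedType.Exports.

Local Open Scope classical_set_scope.
Local Open Scope ring_scope.

Definition measure_rV_display : measure_display -> measure_display.
Proof. exact. Qed.

(* The product sigma-algebra, generated by the coordinates as for n.-tuple T;
   for T = R it is the Borel sigma-algebra. *)
Section measurable_rV.
Context {d} {T : sigmaRingType d}.
Variable n : nat.

Let coors : 'I_n -> 'rV[T]_n -> T := fun i x => x ord0 i.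

Let rV_set0 : g_sigma_preimage coors set0.
Proof. exact: sigma_algebra0. Qed.

Let rV_setC A : g_sigma_preimage coors A -> g_sigma_preimage coors (~` A).
Proof. exact: sigma_algebraC. Qed.

Let rV_bigcup (F : _^nat) : (forall i, g_sigma_preimage coors (F i)) ->
  g_sigma_preimage coors (\bigcup_i (F i)).
Proof. exact: sigma_algebra_bigcup. Qed.

HB.instance Definition _ := @isMeasurable.Build (measure_rV_display d)
  'rV[T]_n (g_sigma_preimage coors) rV_set0 rV_setC rV_bigcup.

End measurable_rV.

Lemma measurable_coord d (T : measurableType d) n (i : 'I_n) :
  measurable_fun [set: 'rV[T]_n] (fun x : 'rV[T]_n => x ord0 i).
Proof.
move=> _ Y mY; rewrite setTI; apply: sub_sigma_algebra => /=.
rewrite -bigcup_seq/=; exists i => /=; first by rewrite mem_index_enum.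
by exists Y => //; rewrite setTI.
Qed.

Lemma measurable_fun_coordP d1 d2 (T1 : measurableType d1)
    (T2 : measurableType d2) n (f : T1 -> 'rV[T2]_n) :
  measurable_fun [set: T1] f <->
  forall i, measurable_fun [set: T1] (fun x => f x ord0 i).
Proof.
split=> [mf i|mf].
  by have := measurableT_comp (@measurable_coord _ T2 _ i) mf.
apply: (@measurability _ _ _ _ _ _
  (\big[setU/set0]_(i < n) preimage_set_system setT
     (fun x : 'rV[T2]_n => x ord0 i) measurable)) => //.
move=> _ [A + <-]; rewrite -bigcup_seq /= => -[i _ [B mB <-]].
by rewrite !setTI; have := mf i measurableT B mB; rewrite setTI.
Qed.

(* The measure structure is put on a named copy of mu: on the variable mu itself
   it would become a default instance applying to every set function. *)
Section sigma_finite_measureP.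
Context d (T : measurableType d) (R : realType) (mu : set T -> \bar R).
Hypothesis mu0 : mu set0 = 0%E.
Hypothesis mu_ge0 : forall A, (0 <= mu A)%E.
Hypothesis mu_sigma_additive : semi_sigma_additive mu.
Hypothesis mu_sigma_finite : sigma_finite setT mu.

Definition sigma_finite_copy : set T -> \bar R := mu.

HB.instance Definition _ := isMeasure.Build _ _ _
  sigma_finite_copy mu0 mu_ge0 mu_sigma_additive.

HB.instance Definition _ := Measure_isSigmaFinite.Build _ _ _
  sigma_finite_copy mu_sigma_finite.

Lemma sigma_finite_measureP :
  exists m : {sigma_finite_measure set T -> \bar R},
    mu = m :> (set T -> \bar R).
Proof. by exists sigma_finite_copy. Qed.

End sigma_finite_measureP.

Section lebesgue_rV.
Context {R : realType}.

Definition cons_rV n (p : R * 'rV[R]_n) : 'rV[R]_n.+1 :=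
  \row_i (if unlift ord0 i is Some j then p.2 ord0 j else p.1).

Lemma cons_rV0 n (p : R * 'rV[R]_n) : cons_rV p ord0 ord0 = p.1.
Proof. by rewrite mxE unlift_none. Qed.

Lemma cons_rVS n (p : R * 'rV[R]_n) j :
  cons_rV p ord0 (lift ord0 j) = p.2 ord0 j.
Proof. by rewrite mxE liftK. Qed.

Lemma measurable_cons_rV n : measurable_fun setT (@cons_rV n).
Proof.
apply/measurable_fun_coordP => i; case: (unliftP ord0 i) => [j|] ->.
  under eq_fun do rewrite cons_rVS.
  exact: (measurableT_comp (@measurable_coord _ _ _ j) measurable_snd).
under eq_fun do rewrite cons_rV0.
exact: measurable_fst.
Qed.

Fixpoint lebesgue_rV {n : nat} : set 'rV[R]_n -> \bar R :=
  match n with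
  | 0 => dirac (0 : 'rV[R]_0)
  | n'.+1 =>
      pushforward (lebesgue_measure \x lebesgue_rV)%E (@cons_rV n')
  end.

Let lebesgue_rV_sigma_finite_measure n :
  exists m : {sigma_finite_measure set 'rV[R]_n -> \bar R},
    lebesgue_rV = m :> (set 'rV[R]_n -> \bar R).
Proof.
elim: n => [|n [m /= mE]].
  have sf : sigma_finite setT (dirac (0 : 'rV[R]_0) : set 'rV[R]_0 -> \bar R).
    apply: fin_num_fun_sigma_finite; first by rewrite measure0.
    by move=> A _; rewrite diracE.
  apply: (@sigma_finite_measureP _ _ _ (dirac (0 : 'rV[R]_0)) _ _ _ sf).
  - exact: measure0.
  - by move=> A; exact: measure_ge0.
  - exact: measure_semi_sigma_additive.
pose l : {sigma_finite_measure set (measurableTypeR R) -> \bar R} :=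
  lebesgue_measure.
pose P := pushforward (l \x m)%E (@cons_rV n).
have mc A : measurable A -> measurable (@cons_rV n @^-1` A).
  by move=> mA; rewrite -[X in measurable X]setTI; exact: measurable_cons_rV.
have P0 : P set0 = 0%E by rewrite /P /pushforward preimage_set0 measure0.
have Pge0 A : (0 <= P A)%E by rewrite /P /pushforward; exact: measure_ge0.
have Psa : semi_sigma_additive P.
  move=> F mF tF mUF; rewrite /P /pushforward preimage_bigcup.
  apply: measure_semi_sigma_additive.
  - by move=> i; exact: mc.
  - apply/trivIsetP => /= i j _ _ ij; rewrite -preimage_setI.
    by move/trivIsetP : tF => /(_ _ _ _ _ ij) ->//; rewrite preimage_set0.
  - by rewrite -preimage_bigcup; exact: mc.
have Psf : sigma_finite setT P.
  have /sigma_finiteP[F [TF ndF Foo]] := sigma_finiteT l.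
  have /sigma_finiteP[G [TG ndG Goo]] := sigma_finiteT m.
  pose hd (x : 'rV[R]_n.+1) : measurableTypeR R := x ord0 ord0.
  pose tl (x : 'rV[R]_n.+1) : 'rV[R]_n := \row_j x ord0 (lift ord0 j).
  have mhd : measurable_fun setT hd by exact: measurable_coord.
  have mtl : measurable_fun setT tl.
    apply/measurable_fun_coordP => i.
    rewrite (_ : (fun x => _) = fun x : 'rV[R]_n.+1 => x ord0 (lift ord0 i)).
      exact: measurable_coord.
    by apply/funext => x; rewrite mxE.
  have hdK a v : hd (cons_rV (a, v)) = a by rewrite /hd cons_rV0.
  have tlK a v : tl (cons_rV (a, v)) = v.
    by apply/rowP => j; rewrite mxE cons_rVS.
  exists (fun i => hd @^-1` F i `&` tl @^-1` G i).
    apply/seteqP; split => // x _.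
    have [i _ Fi] : (\bigcup_i F i) (hd x) by rewrite -TF.
    have [j _ Gj] : (\bigcup_i G i) (tl x) by rewrite -TG.
    exists (maxn i j) => //; split.
      by have /subsetPset := ndF _ _ (leq_maxl i j); apply.
    by have /subsetPset := ndG _ _ (leq_maxr i j); apply.
  move=> i; have [mFi Fi] := Foo i; have [mGi Gi] := Goo i; split.
    apply: measurableI.
      by rewrite -[X in measurable X]setTI; exact: mhd.
    by rewrite -[X in measurable X]setTI; exact: mtl.
  rewrite /P /pushforward (_ : _ @^-1` _ = F i `*` G i); last first.
    by apply/seteqP; split => -[a v] /=; rewrite hdK tlK.
  by rewrite product_measure1E// lte_mul_pinfty// ge0_fin_numE.
have [M PM] := sigma_finite_measureP P0 Pge0 Psa Psf.
by exists M; rewrite -PM /= mE.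
Qed.

Section instance.
Variable n : nat.
Local Notation leb := (@lebesgue_rV n).

Let leb0 : leb set0 = 0%E.
Proof. by have [m ->] := lebesgue_rV_sigma_finite_measure n. Qed.

Let leb_ge0 A : (0 <= leb A)%E.
Proof. by have [m ->] := lebesgue_rV_sigma_finite_measure n. Qed.

Let leb_sigma_additive : semi_sigma_additive leb.
Proof.
have [m ->] := lebesgue_rV_sigma_finite_measure n.
exact: measure_semi_sigma_additive.
Qed.

HB.instance Definition _ := isMeasure.Build _ _ _
  leb leb0 leb_ge0 leb_sigma_additive.

Let leb_sigma_finite : sigma_finite setT leb.
Proof.
have [m ->] := lebesgue_rV_sigma_finite_measure n.
exact: sigma_finiteT.
Qed.

HB.instance Definition _ := Measure_isSigmaFinite.Build _ _ _
  leb leb_sigma_finite.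

End instance.

Lemma lebesgue_rV_prod n (A : 'I_n -> set R) :
  (forall i, measurable (A i)) ->
  lebesgue_rV [set x : 'rV[R]_n | forall i, A i (x ord0 i)] =
  (\prod_(i < n) lebesgue_measure (A i))%E.
Proof.
elim: n A => [|n IH] A mA.
  by rewrite big_ord0 /= diracE mem_set// => -[].
rewrite /= /pushforward big_ord_recl -IH//.
rewrite -product_measure1E//; last first.
  rewrite (_ : mkset _ =
    \bigcap_(i in [set: 'I_n]) ((fun x : 'rV[R]_n => x ord0 i) @^-1`
      A (lift ord0 i))).
    apply: fin_bigcap_measurable => // i _.
    by rewrite -[X in measurable X]setTI; exact: measurable_coord.
  by apply/seteqP; split => x /=; [move=> h i _; exact: h|move=> h i; exact: h].
  exact: mA.
congr (_ _); apply/seteqP; split => -[a v] /=.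
  move=> h; split; first by have := h ord0; rewrite cons_rV0.
  by move=> i; have := h (lift ord0 i); rewrite cons_rVS.
move=> [h0 h] i; case: (unliftP ord0 i) => [j|] ->.
  by rewrite cons_rVS; exact: h.
by rewrite cons_rV0.
Qed.

End lebesgue_rV.

Section dunkl.
Context {R : realType} {N : nat}.
Implicit Types (a x y : 'rV[R]_N) (f : 'rV[R]_N -> R) (k : 'rV[R]_N -> R).
Implicit Types Rt Rp : {fset 'rV[R]_N}.

Definition dotv x y : R := \sum_i x ord0 i * y ord0 i.

(* The norm `|x| provided by the library on 'rV[R]_N is the sup norm. *)
Definition enorm x : R := Num.sqrt (dotv x x).

Definition reflection a x : 'rV[R]_N := x - (2 * (dotv a x / dotv a a)) *: a.

Record root_system Rt : Prop := RootSystem {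
  root_neq0 : 0 \notin Rt ;
  root_line : forall a, a \in Rt ->
    [set` Rt] `&` [set c *: a | c in [set: R]] = [set - a; a] ;
  root_reflection : forall a, a \in Rt ->
    reflection a @` [set` Rt] = [set` Rt] ;
  root_normalised : forall a, a \in Rt -> enorm a ^+ 2 = 2 }.

(* Closure under inverses is automatic, reflections being involutions. *)
Inductive reflection_group Rt : ('rV[R]_N -> 'rV[R]_N) -> Prop :=
| reflection_group_id : reflection_group Rt id
| reflection_group_comp a g : a \in Rt -> reflection_group Rt g ->
    reflection_group Rt (reflection a \o g).

(* No hyperplane separating Rp from -Rp is required, only the partition. *)
Definition positive_subsystem Rt Rp : Prop :=
  [set` Rt] = [set` Rp] `|` [set - a | a in [set` Rp]] /\
  [set` Rp] `&` [set - a | a in [set` Rp]] = set0.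

(* Only the values of k on Rt are relevant. *)
Definition multiplicity Rt k : Prop :=
  (forall a, a \in Rt -> 0 <= k a) /\
  (forall g a, reflection_group Rt g -> a \in Rt -> k (g a) = k a).

Definition dunkl_gamma Rp k : R := \sum_(a <- Rp) k a.

Definition partial (i : 'I_N) f : 'rV[R]_N -> R :=
  fun x => 'D_(delta_mx ord0 i) f x.

(* On the hyperplanes dotv a x = 0, which are null sets, the difference
   quotient has value 0 by the convention 0^-1 = 0. *)
Definition dunkl_op Rp k (i : 'I_N) f : 'rV[R]_N -> R := fun x =>
  partial i f x +
  \sum_(a <- Rp) k a * a ord0 i * ((f x - f (reflection a x)) / dotv a x).

Definition dunkl_grad Rp k f (x : 'rV[R]_N) : 'rV[R]_N :=
  \row_i dunkl_op Rp k i f x.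

Definition dunkl_weight Rp k x : R :=
  \prod_(a <- Rp) (`|dotv a x| `^ (2 * k a)).

Definition dunkl_measure Rp k : set 'rV[R]_N -> \bar R :=
  fun A => (\int[lebesgue_rV]_(x in A) (dunkl_weight Rp k x)%:E)%E.

Definition smooth f : Prop :=
  forall s : seq 'I_N, continuous (foldr partial f s) /\
    forall i x, derivable (foldr partial f s) x (delta_mx ord0 i).

Definition Cc_smooth f : Prop :=
  smooth f /\ compact (closure [set x | f x != 0]).

Lemma dunkl_weight_ge0 Rp k x : 0 <= dunkl_weight Rp k x.
Proof. by apply: prodr_ge0 => a _; exact: powR_ge0. Qed.

Lemma measurable_dotv a : measurable_fun [set: 'rV[R]_N] (dotv a).
Proof.
apply: measurable_sum => i; apply: measurable_funM => //.
exact: measurable_coord.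
Qed.

Lemma measurable_dunkl_weight Rp k :
  measurable_fun [set: 'rV[R]_N] (dunkl_weight Rp k).
Proof.
apply: measurable_prod => a _.
apply: (measurableT_comp (f := fun r : R => r `^ (2 * k a))).
  exact: measurable_powR.
by apply: measurableT_comp => //; exact: measurable_dotv.
Qed.

Section measure.
Variables (Rp : {fset 'rV[R]_N}) (k : 'rV[R]_N -> R).
Local Notation mu := (dunkl_measure Rp k).

Let mu0 : mu set0 = 0%E.
Proof. by rewrite /dunkl_measure integral_set0. Qed.

Let mu_ge0 A : (0 <= mu A)%E.
Proof. by apply: integral_ge0 => x _; rewrite lee_fin dunkl_weight_ge0. Qed.

Let mu_sigma_additive : semi_sigma_additive mu.
Proof.
move=> F mF tF mUF; rewrite /dunkl_measure ge0_integral_bigcup//.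
- apply: is_cvg_ereal_nneg_natsum_cond => n _ _; exact: mu_ge0.
- apply: measurable_funTS; apply/measurable_EFinP.
  exact: measurable_dunkl_weight.
- by move=> x _; rewrite lee_fin dunkl_weight_ge0.
Qed.

HB.instance Definition _ := isMeasure.Build _ _ _ mu mu0 mu_ge0
  mu_sigma_additive.

End measure.

End dunkl.

(* Main.v *)
(* With D = N + 2 gamma, the measure mu_k is invariant under the reflections and
   scales by t ^ D under the dilation x |-> t x. Write |.| for the L^p(mu_k)
   norm and give f the weight 1 / (|x| + e). Since f = f(t .) + (f - f(t .)) and
   the weighted norm of f(t .) is at most t ^ (1 - D / p) times that of f for
   t >= 1, letting t -> 1 yields
       (D / p - 1) |f / (|x| + e)| <= |(x . grad f) / (|x| + e)|.
   Now x . grad f = x . grad_k f - sum_a k_a (f - f o sigma_a), so the right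
   side is at most |grad_k f| + 2 gamma |f / (|x| + e)|; the second term is
   absorbed exactly when p < D / (1 + 2 gamma). Letting e -> 0 gives the Hardy
   inequality |f / |x|| <= C |grad_k f|, and Hoelder's inequality applied to
   f ^ 2 = (f / |x|) (|x| f) concludes. Differentiating along dilations only
   needs the homogeneity of the weight, which is in general not C^1. *)

Require Import Defs.
From mathcomp Require Import all_boot all_order all_algebra finmap.
From mathcomp Require Import all_classical all_reals all_analysis.
From mathcomp Require Import measurable_realfun ring lra.

Set Implicit Arguments.
Unset Strict Implicit.
Unset Printing Implicit Defensive.

Import Order.TTheory GRing.Theory Num.Theory.
Import numFieldNormedType.Exports.

Local Open Scope classical_set_scope.
Local Open Scope ring_scope.

(** * Lebesgue measure and linear maps *)

Section lebesgue_rV_linear.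
Context {R : realType}.
Implicit Types n : nat.

Lemma measurable_preimageT d1 d2 (T1 : measurableType d1)
    (T2 : measurableType d2) (f : T1 -> T2) (A : set T2) :
  measurable_fun [set: T1] f -> measurable A -> measurable (f @^-1` A).
Proof. by move=> mf mA; rewrite -[X in measurable X]setTI; exact: mf. Qed.

Lemma measurable_addr n (v : 'rV[R]_n) :
  measurable_fun [set: 'rV[R]_n] (fun x => x + v).
Proof.
apply/measurable_fun_coordP => i; under eq_fun do rewrite mxE.
by apply: measurable_funD => //; exact: measurable_coord.
Qed.

Lemma measurable_scalemx n (t : R) :
  measurable_fun [set: 'rV[R]_n] (fun x => t *: x).
Proof.
apply/measurable_fun_coordP => i; under eq_fun do rewrite mxE.
by apply: measurable_funM => //; exact: measurable_coord.
Qed.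

Lemma measurable_reflection n (a : 'rV[R]_n) :
  measurable_fun [set: 'rV[R]_n] (reflection a).
Proof.
apply/measurable_fun_coordP => i; rewrite /reflection.
under eq_fun do rewrite !mxE.
apply: measurable_funB; first exact: measurable_coord.
apply: measurable_funM => //; apply: measurable_funM => //.
by apply: measurable_funM => //; exact: measurable_dotv.
Qed.

(** * Translation invariance of Lebesgue measure and its uniqueness up to a factor *)

Lemma lebesgue_measure_translate (a : R) (A : set R) : measurable A ->
  lebesgue_measure ((fun x => x + a) @^-1` A) = lebesgue_measure A.
Proof.
move=> mA.
have mf : measurable_fun [set: measurableTypeR R]
    ((fun x => x + a) : _ -> measurableTypeR R).
  exact: measurable_funD.
pose nu := measure_function_pushforward__canonical__measure_function_Measure
  lebesgue_measure mf.
(* Lebesgue measure is determined by its values on half-open intervals, so only these are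
   compared. *)
apply/esym; apply: (@lebesgue_measure_unique R nu) => //= _ [[b c]] _ <-.
rewrite /nu /= /pushforward.
rewrite (_ : _ @^-1` _ = `]b - a, c - a]%classic); last first.
  by apply/seteqP; split=> x /=; rewrite !in_itv/= ltrBlDr lerBrDr.
rewrite !lebesgue_measure_itv/= !lte_fin ltrD2r.
by case: ifPn => // _; rewrite -!EFinD opprB addrA subrK.
Qed.

(** By induction on the dimension: a translation acts separately on the head and the tail of a
    vector, and a product measure is determined by its values on rectangles. *)
Lemma lebesgue_rV_translate n (v : 'rV[R]_n) (A : set 'rV[R]_n) :
  measurable A -> lebesgue_rV ((fun x => x + v) @^-1` A) = lebesgue_rV A.
Proof.
elim: n v A => [|n IH] v A mA.
  congr (lebesgue_rV _); apply/seteqP; split=> x /=; by rewrite !thinmx0.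
rewrite /= /pushforward.
pose l : {sigma_finite_measure set (measurableTypeR R) -> \bar R} :=
  lebesgue_measure.
pose v' : 'rV[R]_n := \row_j v ord0 (lift ord0 j).
pose T (p : measurableTypeR R * 'rV[R]_n) : measurableTypeR R * 'rV[R]_n :=
  (p.1 + v ord0 ord0, p.2 + v').
have mT : measurable_fun setT T.
  apply: measurable_fun_pair.
    by apply: measurable_funD => //; exact: measurable_fst.
  by apply: (measurableT_comp (measurable_addr v')); exact: measurable_snd.
pose nu := measure_function_pushforward__canonical__measure_function_Measure
  (l \x @lebesgue_rV R n)%E mT.
have cT p : cons_rV p + v = cons_rV (T p).
  apply/rowP => i; rewrite !mxE; case: (unliftP ord0 i) => [j|] -> /=.
    by rewrite !mxE.
  by [].
transitivity (nu (@cons_rV R n @^-1` A)).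
  by rewrite /nu /= /pushforward; congr (_ _); apply/seteqP;
    split=> p /=; rewrite cT.
apply/esym/(@product_measure_unique _ _ _ _ _ l (@lebesgue_rV R n) nu).
  move=> B C mB mC; rewrite /nu /= /pushforward.
  rewrite (_ : T @^-1` (B `*` C) =
    ((fun x => x + v ord0 ord0) @^-1` B) `*` ((fun x => x + v') @^-1` C)) //.
  rewrite product_measure1E//.
  - by rewrite /l /= IH// lebesgue_measure_translate.
  - by apply: measurable_preimageT => //; exact: measurable_funD.
  - by apply: measurable_preimageT => //; exact: measurable_addr.
exact: measurable_preimageT (@measurable_cons_rV R n) mA.
Qed.

(* A measure invariant under translations is proportional to lebesgue_rV:
   compute the integral of 1_A(x) 1_C(y - x) with respect to nu(dx) dy in both
   orders. *)
Lemma translation_invariant_measureM n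
    (nu : {sigma_finite_measure set 'rV[R]_n -> \bar R})
    (C A : set 'rV[R]_n) :
  (forall (v : 'rV[R]_n) (B : set 'rV[R]_n), measurable B ->
    nu ((fun x => x + v) @^-1` B) = nu B) ->
  measurable C -> -%R @^-1` C = C -> measurable A ->
  (lebesgue_rV C * nu A = lebesgue_rV A * nu C)%E.
Proof.
move=> nuD mC CN mA.
pose E1 : set ('rV[R]_n * 'rV[R]_n) := [set p | A p.1 /\ C (p.2 - p.1)].
pose E2 : set ('rV[R]_n * 'rV[R]_n) := [set p | C p.1 /\ A (p.1 + p.2)].
have mcoord (f g : 'rV[R]_n * 'rV[R]_n -> 'rV[R]_n) :
    measurable_fun setT f -> measurable_fun setT g ->
    measurable_fun setT (fun p => f p + g p).
  move=> /measurable_fun_coordP mf /measurable_fun_coordP mg.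
  apply/measurable_fun_coordP => i; under eq_fun do rewrite mxE.
  exact: measurable_funD.
have mE1 : measurable E1.
  apply: measurableI; first exact: (measurable_preimageT measurable_fst).
  apply: (@measurable_preimageT _ _ _ _
    (fun p : 'rV[R]_n * 'rV[R]_n => p.2 - p.1) C) => //.
  apply: mcoord; first exact: measurable_snd.
  under eq_fun do rewrite -scaleN1r.
  exact: (measurableT_comp (@measurable_scalemx n (-1)) measurable_fst).
have mE2 : measurable E2.
  apply: measurableI; first exact: (measurable_preimageT measurable_fst).
  apply: (@measurable_preimageT _ _ _ _
    (fun p : 'rV[R]_n * 'rV[R]_n => p.1 + p.2) A) => //.
  by apply: mcoord; [exact: measurable_fst|exact: measurable_snd].
have intc (m1 : {sigma_finite_measure set 'rV[R]_n -> \bar R}) B c :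
    measurable B ->
    (\int[m1]_x (if x \in B then c else 0%E) = c * m1 B)%E.
  move=> mB; rewrite -integral_cst// [RHS]integral_mkcond.
  by apply: eq_integral => x _; rewrite patchE.
have H (E : set ('rV[R]_n * 'rV[R]_n)) : measurable E ->
  (\int[nu]_x lebesgue_rV (xsection E x) =
   \int[lebesgue_rV]_y nu (ysection E y))%E.
  move=> mE; have := @indic_fubini_tonelli _ _ _ _ R nu (@lebesgue_rV R n) E mE.
  by rewrite indic_fubini_tonelli_FE// indic_fubini_tonelli_GE.
(* For [x] in [A] the section of [E1] at [x] is the translate of [C] by [x]; for other [x] it is
   empty. *)
transitivity (\int[nu]_x lebesgue_rV (xsection E1 x))%E.
  rewrite -intc//; apply: eq_integral => x _.
  case: ifPn => [/set_mem Ax|/negP Ax].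
    rewrite -(lebesgue_rV_translate (- x) mC); congr (lebesgue_rV _).
    by apply/seteqP; split=> y; rewrite /xsection /= inE//= => -[].
  rewrite (_ : xsection E1 x = set0) ?measure0//.
  apply/seteqP; split=> y //; rewrite /xsection/= inE/= => -[Ax' _].
  by apply: Ax; rewrite inE.
(* Translating the variable of [nu] by [y] replaces the condition [C (y - x)] by [C (- x)], which is
   [C x] by symmetry, so that [E1] becomes [E2]. *)
rewrite H//; transitivity (\int[lebesgue_rV]_y nu (ysection E2 y))%E.
  apply: eq_integral => y _; rewrite -(nuD y); last exact: measurable_ysection.
  congr (nu _); apply/seteqP; split => x; rewrite /ysection /= !inE /E1 /E2 /=.
    rewrite opprD addrCA subrr addr0 => -[Ax Cx]; split=> //.
    by rewrite -CN.
  move=> [Cx Ax]; split=> //; rewrite opprD addrCA subrr addr0.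
  by rewrite -CN/= opprK.
(* Exchanging the integrals back, the section of [E2] at [x] in [C] is a translate of [A]. *)
rewrite -H//= -intc//; apply: eq_integral => x _.
case: ifPn => [/set_mem Cx|/negP Cx].
  rewrite -(lebesgue_rV_translate x mA); congr (lebesgue_rV _).
  apply/seteqP; split=> y; rewrite /xsection /= inE/= addrC//.
  by move=> [].
rewrite (_ : xsection E2 x = set0) ?measure0//.
apply/seteqP; split=> y //; rewrite /xsection/= inE/= => -[Cx' _].
by apply: Cx; rewrite inE.
Qed.

(** The pushforward of Lebesgue measure under [L] is translation invariant, because a shift by [v]
    pulls back to a shift by [L' v]. It is sigma-finite because [L'] pulls an exhausting sequence
    back to sets whose [L]-preimages are the original ones. The symmetric set [C] is left free, to
    be chosen so that its preimage is known. *)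
Lemma additive_bijection_lebesgue_rVM n (L L' : 'rV[R]_n -> 'rV[R]_n)
    (C A : set 'rV[R]_n) :
  measurable_fun setT L -> measurable_fun setT L' ->
  cancel L L' -> cancel L' L -> {morph L : x y / x + y} ->
  measurable C -> -%R @^-1` C = C -> measurable A ->
  (lebesgue_rV C * lebesgue_rV (L @^-1` A) =
   lebesgue_rV A * lebesgue_rV (L @^-1` C))%E.
Proof.
move=> mL mL' LK L'K LD mC CN mA.
pose mu := measure_function_pushforward__canonical__measure_function_Measure
  (@lebesgue_rV R n) mL.
have mu_sf : sigma_finite setT mu.
  have /sigma_finiteP[F [TF ndF Foo]] := sigma_finiteT (@lebesgue_rV R n).
  exists (fun i => L' @^-1` F i).
    by rewrite -preimage_bigcup -TF preimage_setT.
  move=> i; have [mFi Fi] := Foo i; split; first exact: measurable_preimageT.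
  rewrite /mu /= /pushforward (_ : _ @^-1` _ = F i)//.
  by apply/seteqP; split=> x /=; rewrite LK.
have [m mE] := sigma_finite_measureP (measure0 mu) (measure_ge0 mu)
  (@measure_semi_sigma_additive _ _ _ mu) mu_sf.
have mD (v : 'rV[R]_n) (B : set 'rV[R]_n) : measurable B ->
    m ((fun x => x + v) @^-1` B) = m B.
  move=> mB; rewrite -mE /mu /= /pushforward.
  rewrite -(lebesgue_rV_translate (L' v) (measurable_preimageT mL mB)).
  by congr (lebesgue_rV _); apply/seteqP; split=> x /=; rewrite LD L'K.
by have := translation_invariant_measureM mD mC CN mA; rewrite -mE.
Qed.

(** * Cubes and dilations *)

Definition cube n (r : R) : set 'rV[R]_n :=
  [set x | forall i, x ord0 i \in `[- r, r]].

Lemma cubeE n (r : R) (x : 'rV[R]_n) :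
  cube r x <-> forall i, `|x ord0 i| <= r.
Proof.
split=> h i; have := h i; rewrite /= in_itv/= ler_norml//.
Qed.

Lemma measurable_cube n r : measurable (@cube n r).
Proof.
rewrite (_ : cube r = \bigcap_(i in [set: 'I_n])
    ((fun x : 'rV[R]_n => x ord0 i) @^-1` `[- r, r]%classic)).
  apply: fin_bigcap_measurable => // i _.
  by apply: measurable_preimageT => //; exact: measurable_coord.
by apply/seteqP; split=> x /=; [move=> h i _; exact: h|move=> h i; exact: h].
Qed.

Lemma lebesgue_rV_cube n (r : R) : 0 < r ->
  lebesgue_rV (@cube n r) = ((2 * r) ^+ n)%:E.
Proof.
move=> r0; rewrite (lebesgue_rV_prod (A := fun=> `[- r, r]%classic))//.
rewrite lebesgue_measure_itv/= lte_fin (_ : - r < r); last first.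
  by rewrite (lt_trans _ r0)// oppr_lt0.
rewrite -EFinB opprK (_ : r + r = 2 * r); last by rewrite mulr_natl mulr2n.
by elim: n => [|n IH]; rewrite ?big_ord0// big_ord_recl IH -EFinM -exprS.
Qed.

(** The factor is read off the unit cube, whose preimage is the cube of half-side [t^-1]. *)
Lemma lebesgue_rV_dilation n (t : R) (A : set 'rV[R]_n) : 0 < t ->
  measurable A ->
  lebesgue_rV ((fun x => t *: x) @^-1` A) = ((t ^- n)%:E * lebesgue_rV A)%E.
Proof.
move=> t0 mA.
have : (lebesgue_rV (@cube n 1) * lebesgue_rV ((fun x => t *: x) @^-1` A) =
    lebesgue_rV A * lebesgue_rV ((fun x => t *: x) @^-1` @cube n 1))%E.
  apply: (@additive_bijection_lebesgue_rVM n _ (fun x => t^-1 *: x)) => //.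
  - exact: measurable_scalemx.
  - exact: measurable_scalemx.
  - by move=> x; rewrite scalerA mulVf ?gt_eqF// scale1r.
  - by move=> x; rewrite scalerA mulfV ?gt_eqF// scale1r.
  - by move=> x y; rewrite scalerDr.
  - exact: measurable_cube.
  - apply/seteqP; split=> x /cubeE h; apply/cubeE => i; have := h i;
      by rewrite mxE normrN.
rewrite (_ : _ @^-1` cube 1 = cube t^-1); last first.
  apply/seteqP; split=> x /cubeE h; apply/cubeE => i; have := h i.
    by rewrite mxE normrM gtr0_norm// -ler_pdivlMl// mulr1.
  by rewrite mxE normrM gtr0_norm// -ler_pdivlMl// mulr1.
rewrite !lebesgue_rV_cube// ?invr_gt0// mulr1 exprMn exprVn EFinM.
rewrite muleCA.
set a := lebesgue_rV _; set b := lebesgue_rV _ => ab.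
have c0 : (2 ^+ n : R)%:E != 0%E by rewrite eqe expf_neq0.
by move/(congr1 (fun z => (((2 : R) ^- n)%:E * z)%E)) : ab;
  rewrite !muleA -!EFinM mulVf ?expf_neq0// !mul1e muleC.
Qed.

(** * Euclidean inner product and reflections *)

Lemma dotvC n (x y : 'rV[R]_n) : dotv x y = dotv y x.
Proof. by apply: eq_bigr => i _; rewrite mulrC. Qed.

Lemma dotvDr n (x y z : 'rV[R]_n) : dotv x (y + z) = dotv x y + dotv x z.
Proof. by rewrite -big_split; apply: eq_bigr => i _; rewrite mxE mulrDr. Qed.

Lemma dotvZr n c (x y : 'rV[R]_n) : dotv x (c *: y) = c * dotv x y.
Proof. by rewrite mulr_sumr; apply: eq_bigr => i _; rewrite mxE mulrCA. Qed.

Lemma dotvBr n (x y z : 'rV[R]_n) : dotv x (y - z) = dotv x y - dotv x z.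
Proof. by rewrite -scaleN1r dotvDr dotvZr mulN1r. Qed.

Lemma dotvv_ge0 n (x : 'rV[R]_n) : 0 <= dotv x x.
Proof. by apply: sumr_ge0 => i _; rewrite -expr2 sqr_ge0. Qed.

Lemma dotv_reflection n (a x y : 'rV[R]_n) : dotv a a != 0 ->
  dotv (reflection a x) (reflection a y) = dotv x y.
Proof.
move=> a0; rewrite /reflection !(dotvBr, dotvZr) !(dotvC (x - _)).
by rewrite !(dotvBr, dotvZr) (dotvC y a) (dotvC y x); field.
Qed.

Lemma reflectionD n (a : 'rV[R]_n) : {morph reflection a : x y / x + y}.
Proof.
by move=> x y; rewrite /reflection dotvDr (mulrDl (dotv a x)) mulrDr;
  rewrite scalerDl opprD addrACA.
Qed.

Lemma reflectionK n (a : 'rV[R]_n) : dotv a a != 0 ->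
  involutive (reflection a).
Proof.
move=> a0 x; rewrite {1}/reflection dotvBr dotvZr -addrA -opprD -scalerDl.
rewrite [X in X *: _](_ : _ = 0) ?scale0r ?subr0//.
by field.
Qed.

(* The proportionality factor is read off a ball, which the reflection
   preserves. *)
Lemma lebesgue_rV_reflection n (a : 'rV[R]_n) (A : set 'rV[R]_n) :
  dotv a a != 0 -> measurable A ->
  lebesgue_rV (reflection a @^-1` A) = lebesgue_rV A.
Proof.
move=> a0 mA; pose C : set 'rV[R]_n := [set x | dotv x x <= n%:R].
have mC : measurable C.
  rewrite (_ : C = (fun x => dotv x x) @^-1` `]-oo, n%:R]%classic).
    apply: measurable_preimageT => //.
    apply: measurable_sum => i.
    by apply: measurable_funM; exact: measurable_coord.
  by apply/seteqP; split=> x /=; rewrite in_itv.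
have CC : reflection a @^-1` C = C.
  by apply/seteqP; split=> x; rewrite /C/= dotv_reflection.
have := @additive_bijection_lebesgue_rVM n (reflection a) (reflection a) C A
  (measurable_reflection a) (measurable_reflection a) (reflectionK a0)
  (reflectionK a0) (reflectionD a) mC _ mA.
rewrite CC (muleC (lebesgue_rV A)) => H.
(* Cancelling the measure of [C] requires it to be positive and finite: [C] contains [cube 1] and
   lies in [cube (n + 1)], whose half-side is positive even for [n = 0]. *)
have C0 : (0 < lebesgue_rV C)%E.
  rewrite (@lt_le_trans _ _ (lebesgue_rV (@cube n 1)))//.
    by rewrite lebesgue_rV_cube// lte_fin exprn_gt0// mulr1.
  apply: le_measure; rewrite ?inE//; first exact: measurable_cube.
  move=> x /cubeE x1; rewrite /C/= /dotv.
  rewrite (le_trans (_ : _ <= \sum_(i < n) 1))//; last first.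
    by rewrite sumr_const card_ord.
  apply: ler_sum => i _; rewrite -expr2 -real_normK ?num_real//.
  by rewrite expr_le1.
have Coo : (lebesgue_rV C < +oo)%E.
  rewrite (@le_lt_trans _ _ (lebesgue_rV (@cube n (n%:R + 1))))//; last first.
    by rewrite lebesgue_rV_cube// ?ltry// ltr_wpDl.
  apply: le_measure; rewrite ?inE//; first exact: measurable_cube.
  move=> x; rewrite /C/= => xn; apply/cubeE => i.
  have : x ord0 i * x ord0 i <= n%:R.
    apply: le_trans xn; rewrite /dotv (bigD1 i)//= lerDl.
    by apply: sumr_ge0 => j _; rewrite -expr2 sqr_ge0.
  rewrite -expr2 -real_normK ?num_real// => h.
  rewrite -(@ler_pXn2r _ 2)// ?nnegrE// (le_trans h)//.
  by have : (0 : R) <= n%:R by []; nra.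
have CN : -%R @^-1` C = C.
  apply/seteqP; split=> x; rewrite /C/= -scaleN1r dotvZr (dotvC _ x) dotvZr;
    by rewrite !mulN1r opprK.
have [c cE] : exists c : R, lebesgue_rV C = c%:E.
  by exists (fine (lebesgue_rV C)); rewrite fineK// gt0_fin_numE.
move: C0 (H CN); rewrite cE lte_fin => c0 /(congr1 (fun z => (c^-1%:E * z)%E)).
by rewrite !muleA -!EFinM mulVf ?gt_eqF// !mul1e.
Qed.

End lebesgue_rV_linear.

(** * Invariance of the Dunkl measure *)

Section dunkl_measure_invariance.
Context {R : realType} {N : nat}.
Implicit Types (a x y : 'rV[R]_N).

Lemma enorm_ge0 x : 0 <= enorm x.
Proof. exact: sqrtr_ge0. Qed.

Lemma enorm_sqr x : enorm x ^+ 2 = dotv x x.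
Proof. by rewrite sqr_sqrtr// dotvv_ge0. Qed.

Lemma dotvv_eq0 x : (dotv x x == 0) = (x == 0).
Proof.
apply/eqP/eqP => [xx0|->]; last first.
  by rewrite /dotv big1// => i _; rewrite mxE mul0r.
apply/rowP => i; rewrite mxE; apply/eqP; rewrite -sqrf_eq0 expr2; apply/eqP.
by apply: (psumr_eq0P _ xx0) => // j _; rewrite -expr2 sqr_ge0.
Qed.

Lemma enorm_eq0 x : (enorm x == 0) = (x == 0).
Proof. by rewrite -sqrf_eq0 enorm_sqr dotvv_eq0. Qed.

Lemma enormZ (c : R) x : 0 <= c -> enorm (c *: x) = c * enorm x.
Proof.
move=> c0; rewrite /enorm dotvZr dotvC dotvZr mulrA -expr2 sqrtrM ?sqr_ge0//.
by rewrite sqrtr_sqr ger0_norm.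
Qed.

Lemma enorm_reflection a x : dotv a a != 0 -> enorm (reflection a x) = enorm x.
Proof. by move=> a0; rewrite /enorm dotv_reflection. Qed.

Lemma dotv_reflectionC a x y : dotv a a != 0 ->
  dotv x (reflection a y) = dotv (reflection a x) y.
Proof. by move=> a0; rewrite -{1}(reflectionK a0 x) dotv_reflection. Qed.

Lemma reflection_self a : dotv a a != 0 -> reflection a a = - a.
Proof.
by move=> a0; rewrite /reflection divff// mulr1 scaler_nat mulr2n opprD addrA
  subrr sub0r.
Qed.

(** Change of variables when the pushforward of [mu] is [c] times [mu]. It serves for reflections,
    with [c = 1], and for dilations, with [c] a power of the ratio. *)
Lemma ge0_integral_pushforward_mscale d (T : measurableType d)
    (mu : {measure set T -> \bar R}) (phi : T -> T) (c : R) (D : set T)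
    (h : T -> \bar R) :
  measurable_fun setT phi -> 0 <= c ->
  (forall A, measurable A -> mu (phi @^-1` A) = (c%:E * mu A)%E) ->
  measurable D -> measurable_fun D h -> (forall z : T, 0 <= h z)%E ->
  (\int[mu]_(x in phi @^-1` D) h (phi x) = c%:E * \int[mu]_(x in D) h x)%E.
Proof.
move=> mphi c0 muphi mD mh h0.
rewrite -(ge0_integral_pushforward mphi mu mD mh)//.
rewrite -[c]/((NngNum c0)%:num) -ge0_integral_mscale//.
pose nu := measure_function_pushforward__canonical__measure_function_Measure
  mu mphi.
apply: (@eq_measure_integral _ _ _ D (mscale (NngNum c0) mu) nu) => A mA _.
by rewrite /nu /= /pushforward /mscale/= muphi.
Qed.

Variables (Rt Rp : {fset 'rV[R]_N}) (k : 'rV[R]_N -> R).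
Hypotheses (hRt : root_system Rt) (hRp : positive_subsystem Rt Rp).
Hypothesis hk : multiplicity Rt k.

Lemma positive_sub_root a : a \in Rp -> a \in Rt.
Proof.
by move=> aRp; have [E _] := hRp; have : [set` Rt] a by rewrite E; left.
Qed.

Lemma multiplicity_ge0 a : a \in Rp -> 0 <= k a.
Proof. by move=> /positive_sub_root; apply: hk.1. Qed.

Lemma dunkl_gamma_ge0 : 0 <= dunkl_gamma Rp k.
Proof.
by rewrite /dunkl_gamma big_seq; apply: sumr_ge0 => a; exact: multiplicity_ge0.
Qed.

Lemma dotv_root a : a \in Rt -> dotv a a = 2.
Proof. by move=> aRt; rewrite -enorm_sqr (root_normalised hRt). Qed.

Lemma dotv_root_neq0 a : a \in Rt -> dotv a a != 0.
Proof. by move=> aRt; rewrite dotv_root. Qed.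

Lemma multiplicity_reflection a b : a \in Rt -> b \in Rt ->
  k (reflection a b) = k b.
Proof.
move=> aRt bRt; apply: (hk.2 (reflection a)) => //.
by rewrite -[reflection a]/(reflection a \o id); constructor => //; constructor.
Qed.

Lemma perm_reflection_roots a : a \in Rt ->
  perm_eq (map (reflection a) Rt) Rt.
Proof.
move=> aRt; have a0 := dotv_root_neq0 aRt.
have Ea := root_reflection hRt aRt; apply: uniq_perm; rewrite ?fset_uniq//.
  by rewrite map_inj_uniq ?fset_uniq//; exact: inv_inj (reflectionK a0).
move=> b; apply/mapP/idP => [[c cRt ->]|bRt].
  by have : [set` Rt] (reflection a c) by rewrite -Ea; exists c.
by have : [set` Rt] b by []; rewrite -Ea => -[c cRt <-]; exists c.
Qed.

Lemma perm_positive_roots : perm_eq Rt (Rp ++ map -%R Rp).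
Proof.
have [E E0] := hRp; apply: uniq_perm; first exact: fset_uniq.
  rewrite cat_uniq fset_uniq (map_inj_uniq oppr_inj) fset_uniq andbT/=.
  apply/hasPn => b /mapP[c cRp ->]; apply/negP => /= Nc.
  suff : (set0 : set 'rV[R]_N) (- c) by [].
  by rewrite -E0; split => //; exists c.
move=> b; rewrite mem_cat; apply/idP/idP.
  move=> bRt; have : [set` Rt] b by []; rewrite E => -[/= ->//|[c cRp <-]].
  by apply/orP; right; apply/mapP; exists c.
case/orP => [/positive_sub_root//|/mapP[c cRp ->]].
by have : [set` Rt] (- c) by rewrite E; right; exists c.
Qed.

(* Rp itself is not stable under reflections; squaring makes the product range
   over Rt, which is. *)
Lemma dunkl_weight_sqr x :
  dunkl_weight Rp k x ^+ 2 = \prod_(b <- Rt) (`|dotv b x| `^ (2 * k b)).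
Proof.
rewrite (perm_big _ perm_positive_roots)/= big_cat/= expr2; congr (_ * _).
rewrite big_map /dunkl_weight big_seq [RHS]big_seq; apply: eq_bigr => b bRp.
have bRt := positive_sub_root bRp.
rewrite -(reflection_self (dotv_root_neq0 bRt)).
rewrite multiplicity_reflection// reflection_self ?dotv_root_neq0//.
by rewrite dotvC [in RHS]dotvC -scaleN1r dotvZr mulN1r normrN.
Qed.

(** Both sides are nonnegative, so their squares may be compared. These are products over all of
    [Rt], which the reflection permutes; it is self-adjoint and preserves [k] on the roots. *)
Lemma dunkl_weight_reflection a x : a \in Rt ->
  dunkl_weight Rp k (reflection a x) = dunkl_weight Rp k x.
Proof.
move=> aRt; apply/eqP; rewrite -(@eqrXn2 _ 2) ?dunkl_weight_ge0//.
rewrite !dunkl_weight_sqr.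
rewrite -[X in _ == X](perm_big _ (perm_reflection_roots aRt)).
rewrite big_map big_seq [X in _ == X]big_seq; apply/eqP/eq_bigr => b bRt.
by rewrite dotv_reflectionC ?dotv_root_neq0// multiplicity_reflection.
Qed.

Lemma dunkl_weight_dilation (t : R) x : 0 < t ->
  dunkl_weight Rp k (t *: x) =
  t `^ (2 * dunkl_gamma Rp k) * dunkl_weight Rp k x.
Proof.
move=> t0; rewrite /dunkl_weight /dunkl_gamma.
elim: (Rp : seq _) => [|a r IH]; first by rewrite !big_nil mulr0 powRr0 mulr1.
rewrite !big_cons IH mulrDr powRD ?(gt_eqF t0) ?implybT//.
by rewrite dotvZr normrM (gtr0_norm t0) powRM ?(ltW t0)// mulrACA.
Qed.

Lemma dunkl_measure_reflection a (A : set 'rV[R]_N) : a \in Rt ->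
  measurable A ->
  dunkl_measure Rp k (reflection a @^-1` A) = dunkl_measure Rp k A.
Proof.
move=> aRt mA; rewrite /dunkl_measure.
under eq_integral do rewrite -(dunkl_weight_reflection _ aRt).
rewrite (ge0_integral_pushforward_mscale (c := 1)
  (h := fun x => (dunkl_weight Rp k x)%:E)) ?mul1e//.
- exact: measurable_reflection.
- move=> B mB; rewrite mul1e; apply: lebesgue_rV_reflection => //.
  exact: dotv_root_neq0.
- apply: measurable_funTS; apply/measurable_EFinP.
  exact: measurable_dunkl_weight.
- by move=> x; rewrite lee_fin dunkl_weight_ge0.
Qed.

(** The Jacobian contributes [t ^- N] and the homogeneity of the weight contributes the power of
    exponent [- 2 gamma]. *)
Lemma dunkl_measure_dilation (t : R) (A : set 'rV[R]_N) : 0 < t ->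
  measurable A ->
  dunkl_measure Rp k ((fun x => t *: x) @^-1` A) =
  ((t `^ (- (N%:R + 2 * dunkl_gamma Rp k)))%:E * dunkl_measure Rp k A)%E.
Proof.
move=> t0 mA; rewrite /dunkl_measure.
pose g := t `^ (- (2 * dunkl_gamma Rp k)).
under eq_integral => x _.
  rewrite (_ : dunkl_weight Rp k x = g * dunkl_weight Rp k (t *: x));
      last first.
    rewrite dunkl_weight_dilation// mulrA -powRD ?(gt_eqF t0) ?implybT//.
    by rewrite addNr powRr0 mul1r.
  rewrite EFinM.
  over.
have mw B : measurable_fun B (fun x => (dunkl_weight Rp k x)%:E).
  apply: measurable_funTS; apply/measurable_EFinP.
  exact: measurable_dunkl_weight.
have mtA := measurable_preimageT (@measurable_scalemx R N t) mA.
rewrite ge0_integralZl_EFin; first last.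
- exact: powR_ge0.
- apply: measurable_funTS; apply/measurable_EFinP.
  exact: (measurableT_comp (measurable_dunkl_weight Rp k)
    (@measurable_scalemx R N t)).
- by move=> x _; rewrite lee_fin dunkl_weight_ge0.
- exact: mtA.
rewrite (ge0_integral_pushforward_mscale (c := t ^- N)
  (h := fun x => (dunkl_weight Rp k x)%:E))//.
- rewrite muleA -EFinM; congr (_%:E * _)%E.
  rewrite /g -powR_mulrn ?ltW// -powRN -powRD ?(gt_eqF t0) ?implybT//.
  by rewrite -opprD addrC.
- exact: measurable_scalemx.
- by rewrite invr_ge0 exprn_ge0// ltW.
- by move=> B mB; exact: lebesgue_rV_dilation.
- by move=> x; rewrite lee_fin dunkl_weight_ge0.
Qed.

Lemma ge0_dunkl_integral_reflection a (h : 'rV[R]_N -> \bar R) : a \in Rt ->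
  measurable_fun setT h -> (forall x, 0 <= h x)%E ->
  (\int[dunkl_measure Rp k]_x h (reflection a x) =
   \int[dunkl_measure Rp k]_x h x)%E.
Proof.
move=> aRt mh h0; have := @ge0_integral_pushforward_mscale _ _
  (dunkl_measure Rp k) (reflection a) 1 setT h.
rewrite preimage_setT mul1e; apply => //; first exact: measurable_reflection.
by move=> A mA; rewrite mul1e; exact: dunkl_measure_reflection.
Qed.

Lemma ge0_dunkl_integral_dilation (t : R) (h : 'rV[R]_N -> \bar R) : 0 < t ->
  measurable_fun setT h -> (forall x, 0 <= h x)%E ->
  (\int[dunkl_measure Rp k]_x h (t *: x) =
   (t `^ (- (N%:R + 2 * dunkl_gamma Rp k)))%:E *
   \int[dunkl_measure Rp k]_x h x)%E.
Proof.
move=> t0 mh h0; rewrite -(@ge0_integral_pushforward_mscale _ _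
  (dunkl_measure Rp k) (fun x => t *: x))//.
- exact: measurable_scalemx.
- exact: powR_ge0.
- by move=> A mA; exact: dunkl_measure_dilation.
Qed.

(** The exponents [2 * k a] are nonnegative on [Rp], so the weight is bounded on the cube. *)
Lemma dunkl_measure_cube_lty (r : R) : 0 < r ->
  (dunkl_measure Rp k (cube r) < +oo)%E.
Proof.
move=> r0; have [M M0 wM] : exists2 M : R, 0 <= M &
    forall x, cube r x -> dunkl_weight Rp k x <= M.
  exists (\prod_(a <- Rp) ((\sum_i `|a ord0 i| * r) `^ (2 * k a))).
    by apply: prodr_ge0 => a _; exact: powR_ge0.
  move=> x /cubeE xr; rewrite /dunkl_weight big_seq [leRHS]big_seq.
  apply: ler_prod => a aRp; rewrite powR_ge0/=.
  apply: ge0_ler_powR; rewrite ?nnegrE//.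
  - by rewrite mulr_ge0// multiplicity_ge0.
  - by apply: sumr_ge0 => i _; rewrite mulr_ge0// ltW.
  - rewrite /dotv (le_trans (ler_norm_sum _ _ _))// ler_sum// => i _.
    by rewrite normrM ler_wpM2l.
rewrite /dunkl_measure.
apply: (@le_lt_trans _ _ (\int[lebesgue_rV]_(x in @cube R N r) (cst M%:E) x)%E);
    last first.
  rewrite integral_cst; last exact: measurable_cube.
  by rewrite /= lebesgue_rV_cube// -EFinM ltry.
apply: ge0_le_integral => //.
- exact: measurable_cube.
- by move=> x _; rewrite lee_fin dunkl_weight_ge0.
- apply: measurable_funTS; apply/measurable_EFinP.
  exact: measurable_dunkl_weight.
Qed.

Lemma rV_set1E x :
  [set x] = [set y | forall i, [set x ord0 i] (y ord0 i)].
Proof.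
apply/seteqP; split=> y /=; first by move=> ->.
by move=> h; apply/rowP => i; rewrite h.
Qed.

Lemma measurable_rV_set1 x : measurable [set x].
Proof.
rewrite (_ : [set x] = \bigcap_(i in [set: 'I_N])
    ((fun y : 'rV[R]_N => y ord0 i) @^-1` [set x ord0 i])).
  apply: fin_bigcap_measurable => // i _.
  by apply: measurable_preimageT => //; exact: measurable_coord.
by rewrite {1}rV_set1E; apply/seteqP; split=> y /= h i; [move=> _|]; exact: h.
Qed.

(** Lets the origin be discarded, where [f x / enorm x] only has a default value. One coordinate
    suffices to produce a null factor. *)
Lemma dunkl_measure_set1 x : (0 < N)%N -> dunkl_measure Rp k [set x] = 0%E.
Proof.
move=> N0; have m1 := measurable_rV_set1 x.
rewrite /dunkl_measure null_set_integral//.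
  apply: measurable_funTS; apply/measurable_EFinP.
  exact: measurable_dunkl_weight.
rewrite rV_set1E.
transitivity (\prod_(i < N) lebesgue_measure [set x ord0 i])%E.
  exact: (lebesgue_rV_prod (A := fun i => [set x ord0 i])).
by rewrite (bigD1 (Ordinal N0))//= lebesgue_measure_set1 mul0e.
Qed.

End dunkl_measure_invariance.

(** * Difference quotients along dilations *)

Section calculus_rV.
Context {R : realType} {N : nat}.
Implicit Types (x y v : 'rV[R]_N) (f : 'rV[R]_N -> R).

Lemma continuous_rV_dist f x : {for x, continuous f} ->
  forall e, 0 < e -> exists r, 0 < r /\
    forall y, (forall i, `|y ord0 i - x ord0 i| <= r) -> `|f y - f x| <= e.
Proof.
move=> cf e e0.
have /nbhs_ballP[r /= r0 xr] : nbhs x [set y | `|f x - f y| < e].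
  by move/cvgrPdist_lt : cf => /(_ _ e0).
(* Halving the radius turns the non-strict coordinate bounds into the strict ones that define a
   ball. *)
exists (r / 2); split; first by rewrite divr_gt0.
move=> y yx; rewrite distrC; apply/ltW/xr; split=> // i j.
rewrite (ord1 i) /ball/= distrC (le_lt_trans (yx j))//.
by rewrite ltr_pdivrMr// ltr_pMr// ltr1n.
Qed.

(** The sigma-algebra is generated by coordinates, not by open sets. Here [gr n] rounds each
    coordinate down to a multiple of [1 / (n + 1)], and [f] is the pointwise limit of the functions
    [f \o gr n]. *)
Lemma continuous_measurable_rV f : continuous f ->
  measurable_fun [set: 'rV[R]_N] f.
Proof.
move=> cf.
pose fl (n : nat) x : 'rV[int]_N := \row_i Num.floor (x ord0 i * n.+1%:R).
pose gr n x : 'rV[R]_N := \row_i ((fl n x ord0 i)%:~R / n.+1%:R).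
have grE n x i : `|gr n x ord0 i - x ord0 i| <= n.+1%:R^-1.
  rewrite !mxE -[X in _ - X](@mulfK _ n.+1%:R)// -mulrBl normrM.
  rewrite [X in _ * X]gtr0_norm ?invr_gt0// ler_piMl// distrC ger0_norm.
    rewrite lerBlDr addrC; apply/ltW; have := floor_itv (x ord0 i * n.+1%:R).
    by rewrite intrD => /andP[].
  rewrite subr_ge0; have := floor_itv (x ord0 i * n.+1%:R).
  by move=> /andP[].
apply: (@measurable_fun_cvg _ _ _ setT (fun n x => f (gr n x))).
  (* The rounded point is determined by an integer vector [z]. There are countably many of these,
     and each fibre is a product of half-open intervals. *)
  move=> n _ B mB; rewrite setTI.
  rewrite (_ : _ @^-1` B = \bigcup_(z : 'rV[int]_N)
      (if `[< B (f (\row_i ((z ord0 i)%:~R / n.+1%:R))) >]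
       then fl n @^-1` [set z] else set0)); last first.
    apply/seteqP; split=> [x Bx|x [z _]].
      by exists (fl n x) => //; rewrite asboolT.
    by case: asboolP => // Bz /= zE; rewrite /gr zE.
  apply: countable_bigcupT_measurable => [|z].
    exact: countableP.
  case: ifP => // _.
  rewrite (_ : fl n @^-1` [set z] = \bigcap_(i in [set: 'I_N])
    ((fun x : 'rV[R]_N => x ord0 i * n.+1%:R) @^-1`
      `[(z ord0 i)%:~R, (z ord0 i + 1)%:~R[%classic)).
    apply: fin_bigcap_measurable => // i _.
    apply: measurable_preimageT => //.
    by apply: measurable_funM => //; exact: measurable_coord.
  apply/seteqP; split=> x /=.
    by move=> <- i _; rewrite /= in_itv/= mxE floor_itv.
  move=> h; apply/rowP => i; rewrite mxE; apply/eqP; rewrite floor_eq.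
  by have := h i I; rewrite /= in_itv.
move=> x _; apply/cvgrPdist_le => e e0.
have [r [r0 xr]] := continuous_rV_dist (cf x) e0.
have /cvgrPdist_le/(_ _ r0) := @cvg_harmonic R.
apply: filterS => n.
rewrite sub0r normrN /harmonic/= ger0_norm ?invr_ge0// => nr.
by rewrite distrC; apply: xr => i; exact: le_trans (grE n x i) nr.
Qed.

Lemma is_derive_line f x v (r : R) : derivable f (x + r *: v) v ->
  is_derive r 1 (fun s : R => f (x + s *: v)) ('D_v f (x + r *: v)).
Proof.
have E : (fun h : R => h^-1 *: (((fun s : R => f (x + s *: v)) \o shift r)
      (h *: (1 : R)) - f (x + r *: v))) =
    (fun h : R => h^-1 *: ((f \o shift (x + r *: v)) (h *: v) -
      f (x + r *: v))).
  apply/funext => h /=; do 2 f_equal; f_equal.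
  by rewrite [h *: 1]mulr1 scalerDl addrCA.
by move=> df; split; rewrite /derivable /derive E.
Qed.

Lemma mean_value_line f x v (r : R) :
  (forall s, derivable f (x + s *: v) v) ->
  exists2 s, `|s| <= `|r| & f (x + r *: v) - f x = r * 'D_v f (x + s *: v).
Proof.
move=> df; pose h (s : R) := f (x + s *: v).
have dh (s : R) : is_derive s (1 : R) h ('D_v f (x + s *: v)).
  exact: is_derive_line.
have ch (A : set R) : {within A, continuous h}.
  apply: continuous_subspaceT => s; apply: differentiable_continuous.
  by apply/derivable1_diffP; exact: ex_derive.
have h0 : h 0 = f x by rewrite /h scale0r addr0.
have [r0|r0|->] := ltgtP r 0; last first.
- by exists 0 => //; rewrite scale0r addr0 subrr mul0r.
- have [s] := MVT r0 (fun s _ => dh s) (ch _).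
  rewrite in_itv/= => /andP[s0 sr]; rewrite h0 subr0 => E.
  by exists s; [rewrite !gtr0_norm// ltW|rewrite -/(h r) E mulrC].
- have [s] := MVT r0 (fun s _ => dh s) (ch _).
  rewrite in_itv/= => /andP[sr s0]; rewrite h0 sub0r => E.
  exists s; first by rewrite !ltr0_norm// lerN2 ltW.
  by rewrite -/(h r) -opprB E mulrN mulrC opprK.
Qed.

(** The coordinates are changed from [x] to [y] one at a time, [z m] having the first [m] of them
    changed. Each step follows a coordinate direction, so partial derivatives suffice, at the price
    of a separate intermediate point for each coordinate. *)
Lemma mean_value_rV f x y :
  (forall i z, derivable f z (delta_mx ord0 i)) ->
  exists2 xi : 'I_N -> 'rV[R]_N,
    (forall i j, `|xi i ord0 j - x ord0 j| <= `|y ord0 j - x ord0 j|) &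
    f y - f x = \sum_i (y ord0 i - x ord0 i) * partial i f (xi i).
Proof.
move=> df.
pose z m : 'rV[R]_N := \row_i (if (i < m)%N then y ord0 i else x ord0 i).
have z0 : z 0 = x by apply/rowP => i; rewrite mxE.
have zN : z N = y by apply/rowP => i; rewrite mxE ltn_ord.
have zS (i : 'I_N) : z i.+1 = z i +
    (y ord0 i - x ord0 i) *: delta_mx ord0 i.
  apply/rowP => j; rewrite !mxE eqxx/= ltnS leq_eqVlt.
  have [->|ji] := eqVneq j i.
    by rewrite eqxx ltnn /= mulr1 addrCA subrr addr0.
  have -> : (j == i :> nat) = false by exact: negbTE ji.
  by rewrite /= mulr0 addr0.
have H (i : 'I_N) : exists w : 'rV[R]_N,
    (forall j, `|w ord0 j - x ord0 j| <= `|y ord0 j - x ord0 j|) /\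
    f (z i.+1) - f (z i) = (y ord0 i - x ord0 i) * partial i f w.
  rewrite zS; have [s sr ->] := mean_value_line (x := z i)
    (y ord0 i - x ord0 i) (fun s => df i _).
  exists (z i + s *: delta_mx ord0 i); split=> // j.
  rewrite !mxE eqxx/=; have [->|ji] := eqVneq j i.
    by rewrite ltnn mulr1 addrAC subrr add0r.
  by rewrite mulr0 addr0; case: ifP => // _; rewrite subrr normr0.
have [xi xiE] := choice H; exists xi; first by move=> i; exact: (xiE i).1.
rewrite -(eq_bigr _ (fun i _ => (xiE i).2)).
by rewrite -(big_mkord xpredT (fun i => f (z i.+1) - f (z i))) telescope_sumr//
  z0 zN.
Qed.

Lemma continuous_bounded_cube f (r : R) : continuous f ->
  exists M, 0 <= M /\ forall x, cube r x -> `|f x| <= M.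
Proof.
move=> cf; have cptA : compact (@cube R N r).
  by apply: rV_compact (fun=> `[- r, r]%classic) _ => i; exact: segment_compact.
have /compact_bounded[M [_ MP]] :
    compact (f @` @cube R N r).
  by apply: continuous_compact => //; exact: continuous_subspaceT.
exists (`|M| + 1); split=> [|x xr]; first by rewrite addr_ge0.
by apply: MP; [rewrite (le_lt_trans (ler_norm _))// ltrDl|exists x].
Qed.

Lemma Cc_smooth_support f : Cc_smooth f ->
  exists2 K, 0 < K & forall x, ~ cube K x -> f x = 0.
Proof.
move=> [_ /compact_bounded[M [_ MP]]]; exists (`|M| + 1).
  by rewrite ltr_wpDl.
move=> x xK; apply: contra_notP xK => /eqP fx0; apply/cubeE => i.
have : `|x| <= `|M| + 1.
  apply: MP; first by rewrite (le_lt_trans (ler_norm _))// ltrDl.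
  exact: subset_closure.
by apply: le_trans; rewrite [leRHS]mx_normrE; apply: (le_bigmax _ _ (ord0, i)).
Qed.

Lemma Cc_smooth_continuous f : Cc_smooth f -> continuous f.
Proof. by move=> [/(_ [::])[]]. Qed.

Lemma Cc_smooth_derivable f i x : Cc_smooth f ->
  derivable f x (delta_mx ord0 i).
Proof. by move=> [/(_ [::])[_]]. Qed.

Lemma Cc_smooth_partial f i : Cc_smooth f -> continuous (partial i f).
Proof. by move=> [/(_ [:: i])[]]. Qed.

(** The radial derivative: the derivative of [f (t *: x)] in [t] at [t = 1], for smooth [f]. *)
Definition euler f x : R := \sum_i x ord0 i * partial i f x.

Definition dilation_quotient f (s : R) x : R := (f ((1 + s) *: x) - f x) / s.

Lemma dilation_quotientE f (s : R) x : s != 0 ->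
  (forall i z, derivable f z (delta_mx ord0 i)) ->
  exists2 xi : 'I_N -> 'rV[R]_N,
    (forall i j, `|xi i ord0 j - x ord0 j| <= `|s * x ord0 j|) &
    dilation_quotient f s x = \sum_i x ord0 i * partial i f (xi i).
Proof.
move=> s0 df; have [xi xiE fE] := mean_value_rV x ((1 + s) *: x) df.
have E j : ((1 + s) *: x) ord0 j - x ord0 j = s * x ord0 j.
  by rewrite mxE mulrDl mul1r addrAC subrr add0r.
exists xi => [i j|]; first by rewrite -E.
rewrite /dilation_quotient fE mulr_suml; apply: eq_bigr => i _.
by rewrite E mulrC !mulrA mulVf// mul1r.
Qed.

Lemma dilation_quotient_cvg f x : Cc_smooth f ->
  dilation_quotient f n.+1%:R^-1 x @[n --> \oo] --> euler f x.
Proof.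
move=> Cf; apply/cvgrPdist_le => e e0.
pose S := \sum_i `|x ord0 i| + 1.
(* The summand 1 keeps [S] positive at [x = 0]. Since [S] bounds every coordinate of [x] and also
   their sum in absolute value, it controls both the displacement of the intermediate points and the
   final sum. *)
have S0 : 0 < S by rewrite ltr_wpDl// sumr_ge0.
have eS0 : 0 < e / S by rewrite divr_gt0.
have [r r0 rP] : exists2 r, 0 < r & forall i y,
    (forall j, `|y ord0 j - x ord0 j| <= r) ->
    `|partial i f y - partial i f x| <= e / S.
  have [r rP] := choice (fun i =>
    continuous_rV_dist (@Cc_smooth_partial f i Cf x) eS0).
  exists (\big[Num.min/1]_i r i).
    by apply: lt_bigmin => // i _; exact: (rP i).1.
  move=> i y xy; apply: (rP i).2 => j; apply: le_trans (xy j) _.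
  exact: bigmin_le.
have rS0 : 0 < r / S by rewrite divr_gt0.
have /cvgrPdist_le/(_ _ rS0) := @cvg_harmonic R.
apply: filterS => n.
rewrite sub0r normrN /harmonic/= ger0_norm ?invr_ge0// => nr.
have [|xi xiE ->] := @dilation_quotientE f n.+1%:R^-1 x _
  (fun i z => @Cc_smooth_derivable f i z Cf).
  by rewrite invr_neq0.
rewrite /euler -sumrB (le_trans (ler_norm_sum _ _ _))//.
have -> : e = S * (e / S) by rewrite mulrCA mulfV ?mulr1// gt_eqF.
apply: (@le_trans _ _ (\sum_i `|x ord0 i| * (e / S))).
  apply: ler_sum => i _; rewrite -mulrBr normrM ler_wpM2l// distrC rP// => j.
  rewrite (le_trans (xiE i j))// normrM ger0_norm ?invr_ge0//.
  apply: (@le_trans _ _ (r / S * S)); last by rewrite divfK// gt_eqF.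
  apply: ler_pM => //; rewrite ?invr_ge0//.
  rewrite /S (bigD1 j)//= -addrA lerDl addr_ge0// sumr_ge0//.
by rewrite -mulr_suml ler_wpM2r ?(ltW eS0)// lerDl.
Qed.

(** Provides the dominating function for the limit [s -> 0]. Dilating by [1 + s] moves points
    outwards, so the quotient vanishes off a cube containing the support; on that cube, [s <= 1]
    keeps the intermediate points in the cube of twice the size. *)
Lemma dilation_quotient_bounded f : Cc_smooth f ->
  exists K M, [/\ 0 < K, 0 <= M & forall s x, 0 < s -> s <= 1 ->
    `|dilation_quotient f s x| <= M * \1_(cube K) x].
Proof.
move=> Cf; have [K K0 fK] := Cc_smooth_support Cf.
have [M M0 MP] : exists2 M, 0 <= M & forall i x, cube (2 * K) x ->
    `|partial i f x| <= M.
  have [M MP] := choice (fun i =>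
    continuous_bounded_cube (2 * K) (@Cc_smooth_partial f i Cf)).
  exists (\sum_i M i); first by apply: sumr_ge0 => i _; exact: (MP i).1.
  move=> i x xK; rewrite (le_trans ((MP i).2 _ xK))// (bigD1 i)//= lerDl.
  by apply: sumr_ge0 => j _; exact: (MP j).1.
exists K, (\sum_(i < N) K * M); split=> //.
  by apply: sumr_ge0 => i _; rewrite mulr_ge0// ltW.
move=> s x s0 s1; rewrite indicE.
have [xK|xK] := pselect (cube K x); last first.
  rewrite memNset// mulr0 /dilation_quotient (fK x xK) (fK ((1 + s) *: x)).
    by rewrite subrr mul0r normr0.
  move=> /cubeE sxK; apply: xK; apply/cubeE => i.
  rewrite (le_trans _ (sxK i))// mxE normrM (@ger0_norm _ (1 + s)) ?addr_ge0
    ?(ltW s0)//.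
  by rewrite mulrDl mul1r lerDl mulr_ge0// ltW.
rewrite mem_set// mulr1.
have [|xi xiE ->] := @dilation_quotientE f s x _
  (fun i z => @Cc_smooth_derivable f i z Cf); first by rewrite gt_eqF.
rewrite (le_trans (ler_norm_sum _ _ _))//; apply: ler_sum => i _.
move/cubeE : xK => xK; rewrite normrM ler_pM// MP//; apply/cubeE => j.
rewrite -[xi i ord0 j](subrK (x ord0 j)) (le_trans (ler_normD _ _))//.
rewrite mulrDl mul1r lerD// (le_trans (xiE i j))// normrM gtr0_norm//.
by rewrite (le_trans _ (xK j))// ler_piMl.
Qed.

End calculus_rV.

(** * Powers and Lp norms *)

Section powR_limits.
Context {R : realType}.
Implicit Types (a p b s : R).

Lemma powR_cvgn (u : nat -> R) a p : 0 < p -> (forall n, 0 <= u n) ->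
  u @ \oo --> a -> u n `^ p @[n --> \oo] --> a `^ p.
Proof.
move=> p0 u0 ua.
have : 0 <= a.
  by rewrite -(cvg_lim _ ua)//; apply: limr_ge; [exact: cvgP ua|exact: nearW].
(* At the limit 0 the logarithm is not continuous, and the bound [e] is obtained directly from its
   [p]-th root; at a positive limit the exponential formula applies. *)
rewrite le_eqVlt => /predU1P[a0|a0].
  rewrite -a0 powR0 ?gt_eqF//; apply/cvgrPdist_le => e e0.
  have ep0 : 0 < e `^ p^-1 by exact: powR_gt0.
  move/cvgrPdist_le : ua => /(_ _ ep0); apply: filterS => n.
  rewrite -a0 !sub0r !normrN !ger0_norm ?powR_ge0// => une.
  rewrite -[e]powRr1 ?(ltW e0)// -(mulVf (lt0r_neq0 p0)) powRrM.
  by apply: ge0_ler_powR; rewrite ?nnegrE ?(ltW p0) ?(ltW ep0).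
have E : {for a, continuous (fun x => expR (p * ln x))}.
  apply: (@continuous_comp _ _ _ (fun x => p * ln x) expR);
    last exact: continuous_expR.
  by apply: continuousM; [exact: cvg_cst|exact: (continuous_ln a0)].
have h := @cvg_comp _ _ _ u _ _ _ _ ua E.
rewrite /powR (gt_eqF a0); apply: cvg_trans h.
apply: near_eq_cvg; near=> n; rewrite /= gt_eqF//.
by near: n; apply: (cvgr_gt a).
Unshelve. all: by end_near. Qed.

(** A first-order lower bound for 1 minus the power, with the denominator cleared. It follows from
    the bounds [1 + b * ln (1 + s)] for the power of exponent [b] and [s / (1 + s)] for the
    logarithm, both from below. *)
Lemma powR_bernoulli b s : 0 < b -> 0 < s ->
  b * s <= (1 + s + b * s) * (1 - (1 + s) `^ (- b)).
Proof.
move=> b0 s0; have t0 : 0 < 1 + s by rewrite addr_gt0.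
have bs0 : 0 < b * s by rewrite mulr_gt0.
have lnt : s / (1 + s) <= ln (1 + s).
  have : -1 < (1 + s)^-1 - 1 by rewrite ltrBrDr addNr invr_gt0.
  move=> /le_ln1Dx; rewrite addrCA subrr addr0 lnV ?posrE// lerNl opprB.
  by apply: le_trans; rewrite le_eqVlt; apply/orP; left; apply/eqP; field;
    rewrite gt_eqF.
have h : (1 + s + b * s) <= (1 + s) * (1 + s) `^ b.
  apply: (@le_trans _ _ ((1 + s) * (1 + b * ln (1 + s)))); last first.
    by rewrite ler_pM2l// /powR gt_eqF// expR_ge1Dx.
  rewrite mulrDr mulr1 lerD2l mulrCA ler_pM2l//.
  by rewrite mulrC -ler_pdivrMr.
have g0 : 0 < (1 + s) `^ b by exact: powR_gt0.
have : (1 + s + b * s) / (1 + s) `^ b <= 1 + s by rewrite ler_pdivrMr.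
by rewrite powRN mulrBr mulr1; lra.
Qed.

End powR_limits.

Section Lnorm_real.
Context d (T : measurableType d) (R : realType).
Variable mu : {measure set T -> \bar R}.
Implicit Types (f g : T -> R) (p : R).
Local Open Scope ereal_scope.

Lemma Lnorm_EFin f p :
  'N[mu]_p%:E[EFin \o f] = (\int[mu]_x (`|f x| `^ p)%:E) `^ p^-1.
Proof. by rewrite unlock. Qed.

Lemma measurable_norm_powR f p : measurable_fun [set: T] f ->
  measurable_fun [set: T] (fun x => (`|f x| `^ p)%:E).
Proof.
move=> mf; apply/measurable_EFinP.
apply: (@measurableT_comp _ _ _ _ _ _ (fun x : R => x `^ p)%R).
  exact: measurable_powR.
exact: measurableT_comp.
Qed.

Lemma le_Lnorm f g p : (0 < p)%R -> measurable_fun [set: T] f ->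
  measurable_fun [set: T] g -> (forall x, `|f x| <= `|g x|)%R ->
  'N[mu]_p%:E[EFin \o f] <= 'N[mu]_p%:E[EFin \o g].
Proof.
move=> p0 mf mg fg; rewrite !Lnorm_EFin.
apply: gt0_ler_poweR; rewrite ?invr_ge0 ?(ltW p0)//.
- rewrite in_itv/= leey andbT; apply: integral_ge0 => x _.
  by rewrite lee_fin powR_ge0.
- rewrite in_itv/= leey andbT; apply: integral_ge0 => x _.
  by rewrite lee_fin powR_ge0.
apply: ge0_le_integral => //.
- exact: measurable_norm_powR.
- exact: measurable_norm_powR.
- by move=> x _; rewrite lee_fin ge0_ler_powR ?nnegrE ?(ltW p0).
Qed.

Lemma ge0_LnormZ c f p : (0 < p)%R -> (0 <= c)%R -> measurable_fun [set: T] f ->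
  'N[mu]_p%:E[EFin \o (fun x => c * f x)%R] = c%:E * 'N[mu]_p%:E[EFin \o f].
Proof.
move=> p0 c0 mf; rewrite !Lnorm_EFin.
under eq_integral do rewrite normrM powRM// (ger0_norm c0) EFinM.
rewrite ge0_integralZl_EFin//; [|exact: measurable_norm_powR|exact: powR_ge0].
rewrite poweRM; first last.
- by apply: integral_ge0 => x _; rewrite lee_fin powR_ge0.
- by rewrite lee_fin powR_ge0.
by rewrite poweR_EFin -powRrM divff ?gt_eqF// powRr1.
Qed.

Lemma Lnorm_sum_le (I : Type) (r : seq I) (f : I -> T -> R) p : (1 <= p)%R ->
  (forall i, measurable_fun [set: T] (f i)) ->
  'N[mu]_p%:E[EFin \o (fun x => \sum_(i <- r) f i x)%R] <=
  \sum_(i <- r) 'N[mu]_p%:E[EFin \o f i].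
Proof.
move=> p1 mf; elim: r => [|i r IH].
  rewrite big_nil (@eq_Lnorm _ _ _ _ _ _ (cst 0)).
    by rewrite Lnorm0// eqe gt_eqF// (lt_le_trans _ p1).
  by move=> x; rewrite /= big_nil.
rewrite big_cons; under eq_Lnorm do rewrite /= big_cons.
apply: le_trans (minkowski_EFin _ _ _ p1) _ => //.
  exact: measurable_sum.
exact: leeD2l.
Qed.

End Lnorm_real.

(** Dominated convergence is applied to the [p]-th powers. The domination makes all integrals
    finite, so the [p]-th root may be taken through its continuity on the reals. *)
Lemma Lnorm_dominated_cvg d (T : measurableType d) (R : realType)
    (mu : {measure set T -> \bar R}) (p : R) (u_ : (T -> R)^nat)
    (u g : T -> R) :
  0 < p -> (forall n, measurable_fun setT (u_ n)) -> measurable_fun setT u ->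
  measurable_fun setT g -> (forall x, u_ n x @[n --> \oo] --> u x) ->
  (forall n x, `|u_ n x| <= g x) -> ('N[mu]_p%:E[EFin \o g] < +oo)%E ->
  ('N[mu]_p%:E[EFin \o u_ n] @[n --> \oo] --> 'N[mu]_p%:E[EFin \o u])%E.
Proof.
move=> p0 mu_ mu' mg u_u u_g gy.
have g0 x : 0 <= g x by exact: le_trans (u_g 0 x).
have ug x : `|u x| <= g x.
  by apply: (@cvgr_to_le _ _ _ _ _ _ _ (cvg_norm (u_u x))); exact: nearW.
have Ig : (\int[mu]_x (`|g x| `^ p)%:E < +oo)%E.
  have := poweR_Lnorm mu (EFin \o g) (lt0r_neq0 p0) => /= <-.
  exact: poweR_lty.
have Ivy (v : T -> R) : measurable_fun setT v -> (forall x, `|v x| <= g x) ->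
    (\int[mu]_x (`|v x| `^ p)%:E)%E \is a fin_num.
  move=> mv vg; rewrite ge0_fin_numE; last first.
    by apply: integral_ge0 => x _; rewrite lee_fin powR_ge0.
  apply: le_lt_trans Ig; apply: ge0_le_integral => //.
  - exact: measurable_norm_powR.
  - exact: measurable_norm_powR.
  - move=> x _; rewrite lee_fin ge0_ler_powR ?nnegrE ?(ltW p0)//.
    by rewrite (ger0_norm (g0 x)).
have : (\int[mu]_x (`|u_ n x| `^ p)%:E @[n --> \oo] -->
    \int[mu]_x (`|u x| `^ p)%:E)%E.
  apply: (@dominated_cvg _ _ _ _ _ _ _ _ (fun x => (`|g x| `^ p)%:E)) => //.
  - by move=> n; exact: measurable_norm_powR.
  - move=> x _; apply: cvg_EFin; first exact: nearW.
    by apply: powR_cvgn => //; exact: cvg_norm.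
  - apply/integrableP; split; first exact: measurable_norm_powR.
    by under eq_integral do rewrite gee0_abs ?lee_fin ?powR_ge0//.
  - move=> n x _; rewrite gee0_abs ?lee_fin ?powR_ge0//.
    rewrite ge0_ler_powR ?nnegrE ?(ltW p0)//.
    by rewrite (ger0_norm (g0 x)).
rewrite -(fineK (Ivy _ mu' ug)) => /fine_cvgP[_ Icvg].
under eq_fun do rewrite Lnorm_EFin.
rewrite Lnorm_EFin -(fineK (Ivy _ mu' ug)) poweR_EFin.
apply: cvg_EFin.
  by apply: nearW => n; rewrite fin_num_poweR// Ivy.
rewrite (_ : fine \o _ = fun n =>
    fine (\int[mu]_x (`|u_ n x| `^ p)%:E) `^ p^-1); last first.
  by apply/funext => n; rewrite /= fine_poweR.
apply: powR_cvgn => //; first by rewrite invr_gt0.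
move=> n; apply/fine_ge0/integral_ge0 => x _.
by rewrite lee_fin powR_ge0.
Qed.

Lemma measurable_funV d (T : measurableType d) (R : realType) (f : T -> R) :
  measurable_fun [set: T] f -> measurable_fun [set: T] (fun x => (f x)^-1).
Proof.
(* The inverse is expressed through a real power, known to be measurable; squaring makes its base
   nonnegative, and at 0 both expressions give 0. *)
move=> mf; rewrite (_ : (fun x => _) = (fun x => f x * (f x ^+ 2) `^ (- 1))).
  apply: measurable_funM => //.
  apply: (@measurableT_comp _ _ _ _ _ _ (fun x : R => x `^ (- 1))).
    exact: measurable_powR.
  by under eq_fun do rewrite expr2; exact: measurable_funM.
apply/funext => x; rewrite powR_inv1 ?sqr_ge0//.
have [->|f0] := eqVneq (f x) 0; first by rewrite mul0r invr0.
by rewrite expr2 invfM mulrA mulfV// mul1r.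
Qed.

(** * Hardy's inequality *)

Section dunkl_hardy.
Context {R : realType} {N : nat}.
Implicit Types (f h : 'rV[R]_N -> R).

Lemma measurable_enorm : measurable_fun [set: 'rV[R]_N] (@enorm R N).
Proof.
rewrite /enorm; apply: (@measurableT_comp _ _ _ _ _ _ (@Num.sqrt R)).
  by apply: continuous_measurable_fun; exact: sqrt_continuous.
by apply: measurable_sum => i; apply: measurable_funM; exact: measurable_coord.
Qed.

(** Cauchy-Schwarz, from the nonnegativity of the squared length of
    [dotv y y *: x - dotv x y *: y]. *)
Lemma dotv_le_enorm (x y : 'rV[R]_N) : `|dotv x y| <= enorm x * enorm y.
Proof.
have [->|y0] := eqVneq y 0.
  rewrite /dotv big1 ?normr0 ?mulr_ge0 ?enorm_ge0// => i _.
  by rewrite mxE mulr0.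
have yy : 0 < dotv y y by rewrite lt0r dotvv_eq0 y0 dotvv_ge0.
rewrite -(@ler_pXn2r _ 2) ?nnegrE ?mulr_ge0 ?enorm_ge0//.
rewrite exprMn !enorm_sqr real_normK ?num_real//.
have := dotvv_ge0 (dotv y y *: x - dotv x y *: y).
rewrite !(dotvBr, dotvZr) !(dotvC (_ *: x - _)) !(dotvBr, dotvZr) (dotvC y x).
rewrite (_ : _ - _ = dotv y y * (dotv x x * dotv y y - dotv x y ^+ 2)).
  by rewrite pmulr_rge0// subr_ge0.
by ring.
Qed.

(** A regularisation of [1 / enorm x]. For [e > 0] it is bounded, so the weighted norms of test
    functions are finite and can be subtracted; being radial, it is invariant under reflections. *)
Definition decay (e : R) (x : 'rV[R]_N) : R := (enorm x + e)^-1.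

Lemma measurable_decay e : measurable_fun [set: 'rV[R]_N] (decay e).
Proof.
apply: measurable_funV; apply: measurable_funD => //.
exact: measurable_enorm.
Qed.

Lemma decay_ge0 e x : 0 < e -> 0 <= decay e x.
Proof. by move=> e0; rewrite invr_ge0 addr_ge0 ?enorm_ge0// ltW. Qed.

Lemma decay_le e x : 0 < e -> decay e x <= e^-1.
Proof.
by move=> e0; rewrite lef_pV2 ?posrE ?ltr_wpDl ?enorm_ge0// lerDr enorm_ge0.
Qed.

Lemma enorm_decay e x : 0 < e -> enorm x * decay e x <= 1.
Proof.
move=> e0; rewrite ler_pdivrMr ?mul1r; last by rewrite ltr_wpDl ?enorm_ge0.
by rewrite lerDl ltW.
Qed.

Lemma dunkl_gradE Rp k f x :
  (forall a, a \in Rp -> dotv a a != 0) ->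
  dotv x (dunkl_grad Rp k f x) =
  euler f x + \sum_(a <- Rp) k a * (f x - f (reflection a x)).
Proof.
move=> a0; rewrite /dotv /euler.
under eq_bigr do rewrite mxE /dunkl_op mulrDr.
rewrite big_split/=; congr (_ + _).
under eq_bigr do rewrite mulr_sumr.
rewrite exchange_big/= big_seq [RHS]big_seq; apply: eq_bigr => a aRp.
set q := _ / dotv a x.
transitivity (\sum_i k a * (a ord0 i * x ord0 i * q)).
  by apply: eq_bigr => i _; ring.
rewrite -mulr_sumr -mulr_suml -/(dotv a x); congr (_ * _); rewrite {}/q.
(* Pairing with [x] produces a factor [dotv a x] that cancels the denominator. Where it vanishes,
   the reflection fixes [x] and both sides are 0. *)
have [ax0|ax0] := eqVneq (dotv a x) 0; last by rewrite mulrC divfK.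
by rewrite /reflection ax0 !mul0r mulr0 scale0r subr0 subrr.
Qed.

Variables (Rt Rp : {fset 'rV[R]_N}) (k : 'rV[R]_N -> R).
Hypotheses (hRt : root_system Rt) (hRp : positive_subsystem Rt Rp).
Hypothesis hk : multiplicity Rt k.
Local Notation mu := (dunkl_measure Rp k).
Local Notation gam := (dunkl_gamma Rp k).
Local Notation D := (N%:R + 2 * gam).

Lemma measurable_euler f : Cc_smooth f -> measurable_fun setT (euler f).
Proof.
move=> Cf; apply: measurable_sum => i; apply: measurable_funM.
  exact: measurable_coord.
by apply: continuous_measurable_rV; exact: Cc_smooth_partial.
Qed.

Lemma measurable_Cc_smooth f : Cc_smooth f -> measurable_fun setT f.
Proof.
by move=> Cf; apply: continuous_measurable_rV; exact: Cc_smooth_continuous.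
Qed.

Lemma measurable_dunkl_op f i : Cc_smooth f ->
  measurable_fun setT (dunkl_op Rp k i f).
Proof.
move=> Cf; apply: measurable_funD.
  by apply: continuous_measurable_rV; exact: Cc_smooth_partial.
apply: measurable_sum => a; apply: measurable_funM => //.
apply: measurable_funM; last by apply: measurable_funV; exact: measurable_dotv.
apply: measurable_funB; first exact: measurable_Cc_smooth.
exact: (measurableT_comp (measurable_Cc_smooth Cf) (measurable_reflection a)).
Qed.

Lemma measurable_dunkl_grad f : Cc_smooth f ->
  measurable_fun setT (dunkl_grad Rp k f).
Proof.
move=> Cf; apply/measurable_fun_coordP => i.
by under eq_fun do rewrite mxE; exact: measurable_dunkl_op.
Qed.

(** * Weighted norms under reflections and dilations *)

Lemma Lnorm_reflection (p : R) a h : a \in Rt -> measurable_fun setT h ->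
  'N[mu]_p%:E[EFin \o (h \o reflection a)]%E = 'N[mu]_p%:E[EFin \o h]%E.
Proof.
move=> aRt mh; rewrite !Lnorm_EFin; congr (_ `^ _)%E.
apply: (ge0_dunkl_integral_reflection hRt hRp hk
  (h := fun x => (`|h x| `^ p)%:E)) => //.
exact: measurable_norm_powR. 
Qed.

Lemma Lnorm_dilation (p t : R) h : 0 < p -> 0 < t -> measurable_fun setT h ->
  ('N[mu]_p%:E[EFin \o (fun x => h (t *: x)%R)] =
   (t `^ (- (D / p)))%:E * 'N[mu]_p%:E[EFin \o h])%E.
Proof.
move=> p0 t0 mh; rewrite !Lnorm_EFin.
rewrite (ge0_dunkl_integral_dilation _ _ t0 (h := fun x => (`|h x| `^ p)%:E)).
- rewrite poweRM; first by rewrite poweR_EFin -powRrM mulNr.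
  + by rewrite lee_fin powR_ge0.
  + by apply: integral_ge0 => x _; rewrite lee_fin powR_ge0.
- exact: measurable_norm_powR.
- by move=> x; rewrite lee_fin powR_ge0.
Qed.

Lemma measurable_mul_decay e h : measurable_fun setT h ->
  measurable_fun setT (fun x => h x * decay e x).
Proof. by move=> mh; apply: measurable_funM => //; exact: measurable_decay. Qed.

(** Substituting [y = t *: x] gives the power of exponent [- D / p] and changes the weight to
    [decay e (t^-1 *: y)], which is at most [t * decay e y] because [t >= 1]. *)
Lemma Lnorm_decay_dilation (p t e : R) h : 0 < p -> 1 <= t -> 0 < e ->
  measurable_fun setT h ->
  ('N[mu]_p%:E[EFin \o (fun x => h (t *: x) * decay e x)%R] <=
   (t `^ (- (D / p - 1)))%:E *
   'N[mu]_p%:E[EFin \o (fun x => h x * decay e x)%R])%E.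
Proof.
move=> p0 t1 e0 mh; have t0 : 0 < t by exact: lt_le_trans t1.
pose g y := h y * decay e (t^-1 *: y).
have E : (fun x => h (t *: x) * decay e x) = (fun x => g (t *: x)).
  by apply/funext => x; rewrite /g scalerA mulVf ?gt_eqF// scale1r.
have md : measurable_fun setT g.
  apply: measurable_funM => //.
  exact: (measurableT_comp (measurable_decay e) (@measurable_scalemx R N t^-1)).
rewrite E Lnorm_dilation//.
have -> : t `^ (- (D / p - 1)) = t `^ (- (D / p)) * t.
  by rewrite opprD opprK powRD ?(gt_eqF t0) ?implybT// powRr1 ?(ltW t0).
rewrite EFinM -muleA lee_pmul2l//; last first.
  by rewrite lte_fin powR_gt0.
rewrite -ge0_LnormZ ?(ltW t0)//; last exact: measurable_mul_decay.
apply: le_Lnorm => //.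
  by apply: measurable_funM => //; exact: measurable_mul_decay.
move=> x; rewrite mulrCA !normrM ler_wpM2l//.
rewrite (ger0_norm (ltW t0)) !ger0_norm ?decay_ge0// /decay.
have x0 := enorm_ge0 x.
rewrite enormZ ?invr_ge0 ?(ltW t0)// -[X in X <= _]mul1r.
rewrite ler_pdivrMr; last by rewrite ltr_wpDl// mulr_ge0// invr_ge0 ltW.
rewrite mulrAC ler_pdivlMr ?ltr_wpDl// mul1r mulrDr mulrA mulfV ?gt_eqF//.
by rewrite mul1r lerD2l ler_peMl// ltW.
Qed.

Lemma Lnorm_decay_lty (p e K M : R) h : 0 < p -> 0 < e -> 0 < K -> 0 <= M ->
  measurable_fun setT h -> (forall x, `|h x| <= M * \1_(cube K) x) ->
  ('N[mu]_p%:E[EFin \o (fun x => h x * decay e x)%R] < +oo)%E.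
Proof.
move=> p0 e0 K0 M0 mh hM.
have mi : measurable_fun setT (\1_(@cube R N K) : _ -> R).
  by apply: measurable_indic; exact: measurable_cube.
have c0 : 0 <= M * e^-1 by rewrite mulr_ge0// invr_ge0 ltW.
apply: (@le_lt_trans _ _
    ('N[mu]_p%:E[EFin \o (fun x => (M * e^-1) * \1_(@cube R N K) x)%R])%E).
  apply: le_Lnorm => //; first exact: measurable_mul_decay.
    exact: measurable_funM.
  move=> x; rewrite normrM (ger0_norm (decay_ge0 x e0)).
  apply: (@le_trans _ _ (M * \1_(cube K) x * e^-1)).
    by rewrite ler_pM ?decay_le// decay_ge0.
  by rewrite mulrAC ler_norm.
rewrite ge0_LnormZ// lte_mul_pinfty// Lnorm_EFin poweR_lty//.
under eq_integral => x _.
  rewrite (_ : (`|\1_(@cube R N K) x| `^ p) = \1_(cube K) x); last first.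
    rewrite indicE; case: (_ \in _); first by rewrite normr1 powR1.
    by rewrite normr0 powR0// gt_eqF.
  over.
rewrite integral_indic ?setIT//; last exact: measurable_cube.
exact: (dunkl_measure_cube_lty hRp hk K0).
Qed.

Lemma Lnorm_decay_fin_num (p e : R) f : 0 < p -> 0 < e -> Cc_smooth f ->
  ('N[mu]_p%:E[EFin \o (fun x => f x * decay e x)%R])%E \is a fin_num.
Proof.
move=> p0 e0 Cf; rewrite ge0_fin_numE ?Lnorm_ge0//.
have [K K0 fK] := Cc_smooth_support Cf.
have [M [M0 fM]] := continuous_bounded_cube K (Cc_smooth_continuous Cf).
apply: (Lnorm_decay_lty p0 e0 K0 M0); first exact: measurable_Cc_smooth.
move=> x; rewrite indicE; have [xK|xK] := pselect (cube K x).
  by rewrite mem_set// mulr1 fM.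
by rewrite memNset// mulr0 fK// normr0.
Qed.

Lemma measurable_dilation_quotient f s : Cc_smooth f ->
  measurable_fun setT (dilation_quotient f s).
Proof.
move=> Cf; apply: measurable_funM => //.
apply: measurable_funB; last exact: measurable_Cc_smooth.
exact: (measurableT_comp (measurable_Cc_smooth Cf)
  (@measurable_scalemx R N (1 + s))).
Qed.

(* The first-order part in s of the triangle inequality
   |f| <= |f(t x)| + |f(t x) - f(x)|, t = 1 + s, for the weighted norm. *)
Lemma Lnorm_decay_dilation_quotient (p e s : R) f :
  1 <= p -> p < D -> 0 < e -> 0 < s -> Cc_smooth f ->
  ((D / p - 1)%:E * 'N[mu]_p%:E[EFin \o (fun x => f x * decay e x)%R] <=
   (1 + s + (D / p - 1) * s)%:E *
   'N[mu]_p%:E[EFin \o (fun x => dilation_quotient f s x * decay e x)%R])%E.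
Proof.
move=> p1 pD e0 s0 Cf; have p0 : 0 < p by exact: lt_le_trans p1.
set b := D / p - 1.
have b0 : 0 < b by rewrite subr_gt0 ltr_pdivlMr// mul1r.
have t0 : 0 < 1 + s by rewrite addr_gt0.
have mf := measurable_Cc_smooth Cf.
have mq := measurable_dilation_quotient s Cf.
have mw := measurable_mul_decay e mq.
have mNw : measurable_fun setT
    (fun x => - 1 * (dilation_quotient f s x * decay e x)).
  by apply: measurable_funM => //; exact: measurable_cst.
set F := Lnorm _ _ _; set Q := Lnorm _ _ _.
(* An infinite right-hand side is trivial; otherwise everything reduces to real arithmetic. *)
have [->|Qfin] := eqVneq Q +oo%E.
  by rewrite gt0_muley ?leey// lte_fin ltr_wpDr// ltW// mulr_gt0.
have : (F <= ((1 + s) `^ (- b))%:E * F + s%:E * Q)%E.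
  apply: (@le_trans _ _
    ('N[mu]_p%:E[EFin \o (fun x => f ((1 + s) *: x) * decay e x)%R] +
     'N[mu]_p%:E[EFin \o (fun x =>
       s * (- 1 * (dilation_quotient f s x * decay e x)))%R])%E).
    rewrite /F (_ : (fun x => f x * decay e x) =
      (fun x => f ((1 + s) *: x) * decay e x) \+
      (fun x => s * (- 1 * (dilation_quotient f s x * decay e x)))); last first.
      apply/funext => x /=; rewrite /dilation_quotient.
      by field; rewrite gt_eqF.
    apply: minkowski_EFin => //.
      apply: measurable_mul_decay.
      exact: (measurableT_comp mf (@measurable_scalemx R N (1 + s))).
    by apply: measurable_funM => //; exact: measurable_cst.
  apply: leeD.
    apply: Lnorm_decay_dilation => //; last by rewrite lerDl ltW.
  rewrite ge0_LnormZ ?(ltW s0)//.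
  rewrite lee_pmul2l//; apply: le_Lnorm => //.
  by move=> x; rewrite mulN1r normrN.
have Ffin : F \is a fin_num by exact: Lnorm_decay_fin_num.
have Qge0 : (0 <= Q)%E by exact: Lnorm_ge0.
have QE : Q = (fine Q)%:E by rewrite fineK// ge0_fin_numE// lt_neqAle Qfin leey.
have F0 : 0 <= fine F by apply: fine_ge0; exact: Lnorm_ge0.
rewrite QE -(fineK Ffin) -!EFinM -EFinD !lee_fin => H.
(* At this point [F * (1 - z) <= s * Q]; the Bernoulli bound replaces [1 - z] by a multiple of [s],
   which then cancels. *)
have := powR_bernoulli b0 s0; set z := (1 + s) `^ (- b) in H * => B.
have t1 : 0 < 1 + s + b * s by rewrite ltr_wpDr// ltW// mulr_gt0.
rewrite -(ler_pM2l s0).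
apply: (@le_trans _ _ ((1 + s + b * s) * (1 - z) * fine F)).
  by rewrite mulrA (mulrC s) ler_wpM2r.
rewrite mulrCA -mulrA ler_pM2l//; lra.
Qed.

(** The previous inequality is taken along [s = 1 / (n + 1)]. Its left side does not depend on [s];
    on the right the constant tends to 1 and the norm converges by domination. *)
Lemma Lnorm_decay_euler (p e : R) f :
  1 <= p -> p < D -> 0 < e -> Cc_smooth f ->
  ((D / p - 1)%:E * 'N[mu]_p%:E[EFin \o (fun x => f x * decay e x)%R] <=
   'N[mu]_p%:E[EFin \o (fun x => euler f x * decay e x)%R])%E.
Proof.
move=> p1 pD e0 Cf; have p0 : 0 < p by exact: lt_le_trans p1.
have [K [M [K0 M0 KM]]] := dilation_quotient_bounded Cf.
pose s n : R := n.+1%:R^-1.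
have s0 n : 0 < s n by rewrite invr_gt0.
have s1 n : s n <= 1 by rewrite invf_le1// ler1n.
have mi : measurable_fun setT (fun x => M * \1_(@cube R N K) x).
  by apply: measurable_funM => //; apply: measurable_indic;
    exact: measurable_cube.
have Qcvg : ('N[mu]_p%:E[EFin \o
      (fun x => dilation_quotient f (s n) x * decay e x)%R] @[n --> \oo] -->
    'N[mu]_p%:E[EFin \o (fun x => euler f x * decay e x)%R])%E.
  apply: (@Lnorm_dominated_cvg _ _ _ _ _ (fun n x =>
    dilation_quotient f (s n) x * decay e x) _
    (fun x => (M * \1_(@cube R N K) x) * decay e x)) => //.
  - move=> n; apply: measurable_mul_decay.
    exact: measurable_dilation_quotient.
  - by apply: measurable_mul_decay; exact: measurable_euler.
  - exact: measurable_mul_decay.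
  - by move=> x; apply: cvgM; [exact: dilation_quotient_cvg|exact: cvg_cst].
  - move=> n x; rewrite normrM (ger0_norm (decay_ge0 x e0)).
    by rewrite ler_wpM2r ?decay_ge0// KM.
  - apply: (Lnorm_decay_lty p0 e0 K0 M0) => //.
    by move=> x; rewrite ger0_norm// mulr_ge0.
have cvg1 : (1 + s n + (D / p - 1) * s n) @[n --> \oo] --> (1 : R).
  have sc : s n @[n --> \oo] --> (0 : R) := @cvg_harmonic R.
  have : (1 + s n + (D / p - 1) * s n) @[n --> \oo] -->
      1 + 0 + (D / p - 1) * (0 : R).
    apply: cvgD; first by apply: cvgD => //; exact: cvg_cst.
    by apply: cvgM => //; exact: cvg_cst.
  by rewrite mulr0 !addr0.
rewrite -[leRHS]mul1e; apply: (@cvge_ge nat \oo); last first.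
  have ecvg1 : (1 + s n + (D / p - 1) * s n)%:E @[n --> \oo] --> 1%:E.
    by apply: cvg_EFin => //; exact: nearW.
  (* The product of the limits is never of the form 0 times infinity, since the first limit is 1. *)
  apply: cvgeM ecvg1 Qcvg; case: (Lnorm _ _ _) => [r||] //=;
    exact: oner_neq0.
by apply: nearW => n; exact: Lnorm_decay_dilation_quotient.
Qed.

(** By [dunkl_gradE], the radial derivative is the pairing of [x] with the Dunkl gradient minus
    differences along reflections. The pairing is controlled by Cauchy-Schwarz and
    [enorm x * decay e x <= 1]; the weight enters the differences unchanged, being invariant under
    reflections. *)
Lemma Lnorm_euler_decay_le (p e : R) f : 1 <= p -> 0 < e -> Cc_smooth f ->
  ('N[mu]_p%:E[EFin \o (fun x => euler f x * decay e x)%R] <=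
   'N[mu]_p%:E[EFin \o (fun x => enorm (dunkl_grad Rp k f x))] +
   (2 * gam)%:E * 'N[mu]_p%:E[EFin \o (fun x => f x * decay e x)%R])%E.
Proof.
move=> p1 e0 Cf; have p0 : 0 < p by exact: lt_le_trans p1.
pose fe x := f x * decay e x.
have mfe : measurable_fun setT fe.
  by apply: measurable_mul_decay; exact: measurable_Cc_smooth.
have mfea a : measurable_fun setT (fe \o reflection a).
  exact: (measurableT_comp mfe (measurable_reflection a)).
have mNfea a : measurable_fun setT (fun x => - 1 * (fe \o reflection a) x).
  by apply: measurable_funM => //; exact: measurable_cst.
pose dif a x := fe x + - 1 * (fe \o reflection a) x.
have mdif a : measurable_fun setT (dif a) by exact: measurable_funD.
pose Ndif a x := - 1 * (k a * dif a x).
have mkdif a : measurable_fun setT (fun x => k a * dif a x).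
  by apply: measurable_funM => //; exact: measurable_cst.
have mNdif a : measurable_fun setT (Ndif a).
  by apply: measurable_funM => //; exact: measurable_cst.
have mg : measurable_fun setT (fun x => enorm (dunkl_grad Rp k f x)).
  exact: (measurableT_comp measurable_enorm (measurable_dunkl_grad Cf)).
pose rad x := dotv x (dunkl_grad Rp k f x) * decay e x.
have mrad : measurable_fun setT rad.
  apply: measurable_mul_decay; apply: measurable_sum => i.
  apply: measurable_funM; first exact: measurable_coord.
  by under eq_fun do rewrite mxE; exact: measurable_dunkl_op.
have E : (fun x => euler f x * decay e x) =
    rad \+ (fun x => \sum_(a <- Rp) Ndif a x).
  apply/funext => x /=; rewrite /rad dunkl_gradE => [|a aRp]; last first.
    exact: (dotv_root_neq0 hRt (positive_sub_root hRp aRp)).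
  rewrite mulrDl -addrA [X in _ + X](_ : _ = 0) ?addr0//.
  rewrite mulr_suml -big_split/= big_seq big1// => a aRp.
  rewrite /Ndif /dif /fe /= /decay enorm_reflection; first by ring.
  exact: (dotv_root_neq0 hRt (positive_sub_root hRp aRp)).
rewrite E; apply: le_trans (minkowski_EFin mu mrad _ p1) _.
  exact: measurable_sum.
apply: leeD.
  apply: le_Lnorm => // x; rewrite /rad normrM (ger0_norm (decay_ge0 x e0)).
  rewrite (ger0_norm (enorm_ge0 _)).
  apply: (@le_trans _ _ (enorm x * decay e x * enorm (dunkl_grad Rp k f x))).
    by rewrite mulrAC ler_wpM2r ?decay_ge0// dotv_le_enorm.
  by rewrite ler_piMl ?enorm_ge0// enorm_decay.
apply: le_trans (Lnorm_sum_le _ _ p1 mNdif) _.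
have Ffin : ('N[mu]_p%:E[EFin \o fe])%E \is a fin_num.
  exact: (Lnorm_decay_fin_num).
set F := ('N[mu]_p%:E[EFin \o fe])%E in Ffin *.
(* Each difference costs two copies of [F], as reflections preserve the norm; summing over [Rp]
   gives [2 * gam * F]. *)
apply: (@le_trans _ _ (\sum_(a <- Rp) (k a)%:E * (F + F))%E).
  rewrite big_seq [leRHS]big_seq; apply: lee_sum => a aRp.
  have ka0 := multiplicity_ge0 hRp hk aRp.
  apply: (@le_trans _ _ ('N[mu]_p%:E[EFin \o (fun x => k a * dif a x)%R])%E).
    by apply: le_Lnorm => // x; rewrite /Ndif mulN1r normrN.
  rewrite ge0_LnormZ//; apply: lee_wpmul2l; first by rewrite lee_fin.
  apply: le_trans (minkowski_EFin mu mfe (mNfea a) p1) _; apply: leeD2l.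
  rewrite /F -(Lnorm_reflection p (positive_sub_root hRp aRp) mfe).
  by apply: le_Lnorm => // x; rewrite mulN1r normrN.
rewrite -(fineK Ffin) -EFinD; under eq_bigr do rewrite -EFinM.
rewrite sumEFin -mulr_suml -EFinM lee_fin -/gam le_eqVlt; apply/orP; left.
by apply/eqP; ring.
Qed.

(** The reflection term of [Lnorm_euler_decay_le] is moved to the left, which is legitimate because
    the weighted norm is finite. The resulting constant does not depend on [e]. *)
Lemma Lnorm_decay_hardy (p e : R) f : 1 <= p -> p * (1 + 2 * gam) < D ->
  0 < e -> Cc_smooth f ->
  ((D / p - 1 - 2 * gam)%:E *
     'N[mu]_p%:E[EFin \o (fun x => f x * decay e x)%R] <=
   'N[mu]_p%:E[EFin \o (fun x => enorm (dunkl_grad Rp k f x))])%E.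
Proof.
move=> p1 pD e0 Cf; have p0 : 0 < p by exact: lt_le_trans p1.
have gam0 := dunkl_gamma_ge0 hRp hk.
have pD' : p < D.
  by apply: le_lt_trans pD; rewrite ler_peMr ?(ltW p0)// lerDl mulr_ge0.
have := le_trans (Lnorm_decay_euler p1 pD' e0 Cf)
  (Lnorm_euler_decay_le p1 e0 Cf).
have Ffin : ('N[mu]_p%:E[EFin \o (fun x => f x * decay e x)%R])%E \is a fin_num.
  exact: (Lnorm_decay_fin_num).
rewrite -(fineK Ffin); set A := Lnorm _ _ (_ \o (fun x => enorm _)).
have [->|Ay] := eqVneq A +oo%E; first by move=> _; rewrite leey.
have Afin : A \is a fin_num.
  by rewrite ge0_fin_numE ?Lnorm_ge0// lt_neqAle Ay leey.
rewrite -(fineK Afin) -!EFinM -EFinD !lee_fin; lra.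
Qed.

(** As [e = 1 / (n + 1)] decreases to 0 the weights increase, so the uniform bound passes to the
    limit by monotone convergence of the [p]-th powers. *)
Lemma Lnorm_hardy (p : R) f : 1 <= p -> p * (1 + 2 * gam) < D ->
  Cc_smooth f ->
  ('N[mu]_p%:E[EFin \o (fun x => f x / enorm x)%R] <=
   ((D / p - 1 - 2 * gam)^-1)%:E *
   'N[mu]_p%:E[EFin \o (fun x => enorm (dunkl_grad Rp k f x))])%E.
Proof.
move=> p1 pD Cf; have p0 : 0 < p by exact: lt_le_trans p1.
have b0 : 0 < D / p - 1 - 2 * gam.
  by rewrite -addrA -opprD subr_gt0 ltr_pdivlMr// mulrC.
set b := _ - 2 * gam in b0 *; set A := Lnorm _ _ (_ \o (fun x => enorm _)).
have A0 : (0 <= (b^-1)%:E * A)%E.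
  by rewrite mule_ge0 ?Lnorm_ge0// lee_fin invr_ge0 ltW.
pose s n : R := n.+1%:R^-1.
have s0 n : 0 < s n by rewrite invr_gt0.
pose u n x := (`|f x * decay (s n) x| `^ p)%:E.
have mfd n : measurable_fun setT (fun x => f x * decay (s n) x).
  by apply: measurable_mul_decay; exact: measurable_Cc_smooth.
have mu_ n : measurable_fun setT (u n) by exact: measurable_norm_powR.
have u0 n x : (0 <= u n x)%E by rewrite lee_fin powR_ge0.
have ndu x : {homo u^~ x : n m / (n <= m)%N >-> (n <= m)%E}.
  move=> n m nm; rewrite lee_fin ge0_ler_powR ?nnegrE ?(ltW p0)// !normrM.
  rewrite ler_wpM2l// !ger0_norm ?decay_ge0//.
  rewrite lef_pV2 ?posrE ?ltr_wpDl ?enorm_ge0// lerD2l.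
  by rewrite lef_pV2 ?posrE// ler_nat.
have cu x : cvgn (u^~ x) by exact: ereal_nondecreasing_is_cvgn.
have lu x : ((`|f x / enorm x| `^ p)%:E <= limn (u^~ x))%E.
  (* At the origin the quotient is 0 by default while the limit may be infinite, so only an
     inequality is claimed. *)
  have [x0|x0] := eqVneq (enorm x) 0.
    rewrite x0 invr0 mulr0 normr0 powR0 ?gt_eqF//.
    by apply: lime_ge; [exact: cu|exact: nearW].
  suff : u^~ x @ \oo --> (`|f x / enorm x| `^ p)%:E by move/cvg_lim => ->.
  apply: cvg_EFin; first exact: nearW.
  apply: powR_cvgn => //; apply: cvg_norm; apply: cvgM; first exact: cvg_cst.
  apply: cvgV => //; rewrite -[X in _ --> X]addr0.
  by apply: cvgD; [exact: cvg_cst|exact: (@cvg_harmonic R)].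
have Iu n : (\int[mu]_x u n x <= ((b^-1)%:E * A) `^ p)%E.
  have := poweR_Lnorm mu (EFin \o (fun x => f x * decay (s n) x))
    (lt0r_neq0 p0) => /= <-.
  apply: gt0_ler_poweR; rewrite ?(ltW p0)//.
  - by rewrite in_itv/= leey andbT Lnorm_ge0.
  - by rewrite in_itv/= leey andbT.
  rewrite muleC lee_pdivlMr// muleC; exact: Lnorm_decay_hardy.
have Iv : (\int[mu]_x (`|f x / enorm x| `^ p)%:E <= ((b^-1)%:E * A) `^ p)%E.
  have mv : measurable_fun setT (fun x => f x / enorm x).
    apply: measurable_funM; first exact: measurable_Cc_smooth.
    by apply: measurable_funV; exact: measurable_enorm.
  have := cvg_monotone_convergence (mu := mu) measurableT mu_
    (fun n x _ => u0 n x) (fun x _ => ndu x).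
  move=> Icvg; apply: (@le_trans _ _ (\int[mu]_x limn (u^~ x))%E).
    apply: ge0_le_integral => //.
    - exact: measurable_norm_powR.
    - apply: (emeasurable_fun_cvg u) => // x _; exact: cu.
  apply: (@cvge_le nat \oo _ _ _ _ _ _ Icvg); exact: nearW.
rewrite Lnorm_EFin.
(* The right-hand side is written as the [p]-th root of its [p]-th power, to be compared with
   [Iv]. *)
rewrite -[leRHS]poweRe1// -[X in (_ <= _ `^ X)%E](divff (lt0r_neq0 p0)) poweRrM.
apply: gt0_ler_poweR; rewrite ?invr_ge0 ?(ltW p0)//.
- rewrite in_itv/= leey andbT; apply: integral_ge0 => x _.
  by rewrite lee_fin powR_ge0.
- by rewrite in_itv/= leey andbT poweR_ge0.
Qed.

End dunkl_hardy.

(** * The inequality deduced from those of Hardy and Hoelder *)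

Theorem theorem3p5 (R : realType) (N : nat) (hN : (1 <= N)%N)
    (Rt Rp : {fset 'rV[R]_N}) (k : 'rV[R]_N -> R)
    (hRt : root_system Rt) (hRp : positive_subsystem Rt Rp)
    (hk : multiplicity Rt k)
    (p q : R) (hp1 : 1 < p)
    (hp2 : p < (N%:R + 2 * dunkl_gamma Rp k) / (1 + 2 * dunkl_gamma Rp k))
    (hpq : p^-1 + q^-1 = 1) :
  exists2 c : R, 0 < c &
    forall f : 'rV[R]_N -> R, Cc_smooth f ->
      (\int[dunkl_measure Rp k]_x (`|f x| ^+ 2)%:E <=
       c%:E *
       (\int[dunkl_measure Rp k]_x (enorm (dunkl_grad Rp k f x) `^ p)%:E)
         `^ (p^-1) *
       (\int[dunkl_measure Rp k]_x (enorm x `^ q * `|f x| `^ q)%:E)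
         `^ (q^-1))%E.
Proof.
have gam0 := dunkl_gamma_ge0 hRp hk.
have p0 : 0 < p by exact: lt_trans hp1.
have q0 : 0 < q.
  rewrite -invr_gt0 -(ltrD2l p^-1) hpq addr0.
  by rewrite invf_lt1.
have pD : p * (1 + 2 * dunkl_gamma Rp k) < N%:R + 2 * dunkl_gamma Rp k.
  by rewrite -ltr_pdivlMr// ltr_pwDl// mulr_ge0.
(* The constant is that of [Lnorm_hardy]; it is positive by [pD]. *)
exists ((N%:R + 2 * dunkl_gamma Rp k) / p - 1 - 2 * dunkl_gamma Rp k)^-1.
  by rewrite invr_gt0 -addrA -opprD subr_gt0 ltr_pdivlMr// mulrC.
move=> f Cf; have := Lnorm_hardy hRt hRp hk (ltW hp1) pD Cf.
set b := (_ - _)^-1 => hardy.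
pose v x := f x / enorm x; pose w x := enorm x * f x.
have mf := measurable_Cc_smooth Cf.
have mv : measurable_fun setT v.
  apply: measurable_funM => //; apply: measurable_funV.
  exact: measurable_enorm.
have mw : measurable_fun setT w.
  by apply: measurable_funM => //; exact: measurable_enorm.
apply: (@le_trans _ _ ('N[dunkl_measure Rp k]_1[EFin \o (v \* w)%R])%E).
  rewrite Lnorm1; apply: ae_ge0_le_integral => //.
  - apply/measurable_EFinP; under eq_fun do rewrite expr2.
    by apply: measurable_funM; exact: measurableT_comp.
  - apply: measurableT_comp => //; apply/measurable_EFinP.
    exact: measurable_funM.
  have null : dunkl_measure Rp k [set 0] = 0%E by exact: dunkl_measure_set1.
  (* The product [v x * w x] equals [f x ^+ 2] except possibly at the origin, where it is 0 by
     default; hence a comparison almost everywhere. *)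
  exists [set 0]; split => //; first exact: measurable_rV_set1.
  move=> x /=; apply: contra_notP => x0 _.
  rewrite lee_fin /= /v /w (_ : _ * _ = f x ^+ 2) ?normrX//.
  by field; rewrite enorm_eq0; apply/eqP.
apply: le_trans (hoelder _ mv mw p0 q0 hpq) _.
rewrite !Lnorm_EFin in hardy *.
apply: (@lee_pmul _ _ _ _ _) => //.
- exact: poweR_ge0.
- exact: poweR_ge0.
- move: hardy; under [X in (_ <= b%:E * X `^ _)%E -> _]eq_integral do
    rewrite (ger0_norm (enorm_ge0 _)).
  by [].
rewrite le_eqVlt; apply/orP; left; apply/eqP; congr (_ `^ _)%E.
apply: eq_integral => x _; rewrite /w normrM (ger0_norm (enorm_ge0 _)) powRM//.
exact: enorm_ge0.
Qed.
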